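(* Let $\epsilon > 0$ and let $v_1, \dots, v_m$ be independent random vectors in $\mathbb{C}^d$ with finite support such that $$\sum_{i=1}^m \mathbb{E}\left[ v_i v_i^{*}\right] = I_d$$ and $$\mathbb{E}\left[\|v_i\|^2\right] \le \epsilon \quad \text{for all } i.$$ Then $$\mathbb{P}\left[\, \left\| \sum_{i=1}^m v_i v_i^{*} \right\| \le (1+\sqrt{\epsilon})^2 \right] > 0.$$
   Context: For a vector $x$, $\|x\|$ is the Euclidean norm; for a matrix $M$, $\|M\| = \max_{\|x\|=1}\|Mx\|$ is the operator norm. $I_d$ is the $d\times d$ identity matrix and $v^*$ is the conjugate transpose of the column vector $v$. A random vector has finite support if it takes only finitely many values. *)

(* Defs.v *)
From HB Require Import structures.
From mathcomp Require Import all_boot all_order all_algebra.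
From mathcomp Require Import all_classical all_reals all_analysis.
From mathcomp Require Import complex.

Set Implicit Arguments.
Unset Strict Implicit.
Unset Printing Implicit Defensive.

Import Order.TTheory GRing.Theory Num.Theory.
Import numFieldNormedType.Exports.

Local Open Scope classical_set_scope.
Local Open Scope ring_scope.
Local Open Scope complex_scope.

(* Not the MathComp-Analysis norm `|x| on matrices, which is the sup norm. *)
Definition enorm (R : realType) (n : nat) (x : 'cV[R[i]]_n) : R :=
  Num.sqrt (\sum_(i < n) Normc.normc (x i 0) ^+ 2).

(* The set is bounded and the supremum is attained when n > 0; for n = 0 the
   set is empty and the value is 0. *)
Definition opnorm (R : realType) (m n : nat) (M : 'M[R[i]]_(m, n)) : R :=
  sup [set enorm (M *m x) | x in [set x : 'cV[R[i]]_n | enorm x = 1]].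

Definition adjmx (R : realType) (m n : nat) (M : 'M[R[i]]_(m, n)) :
  'M[R[i]]_(n, m) := map_mx Num.conj M^T.

(* C^d with its Borel sigma-algebra; R[i]^o carries the topology of the
   modulus. *)
Definition Cvec (R : realType) (d : nat) : measurableType _ :=
  g_sigma_algebraType (open : set (set 'cV[R[i]^o]_d)).

Definition mutually_independent (dT dS : measure_display)
    (T : measurableType dT) (S : measurableType dS) (R : realType)
    (P : probability T R) (I : finType) (X : I -> {RV P >-> S}) : Prop :=
  forall (J : {set I}) (B : I -> set S),
    (forall i, i \in J -> measurable (B i)) ->
    P (\bigcap_(i in [set` J]) (X i @^-1` B i)) =
    (\prod_(i in J) P (X i @^-1` B i))%E.

Definition finitely_supported (dT dS : measure_display)
    (T : measurableType dT) (S : measurableType dS) (R : realType)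
    (P : probability T R) (X : {RV P >-> S}) : Prop :=
  finite_set (range X).

Definition expectationC (dT : measure_display) (T : measurableType dT)
    (R : realType) (P : probability T R) (f : T -> R[i]) : R[i] :=
  fine 'E_P[fun w => complex.Re (f w)] +i* fine 'E_P[fun w => complex.Im (f w)].

Definition expectation_mx (dT : measure_display) (T : measurableType dT)
    (R : realType) (P : probability T R) (m n : nat)
    (A : T -> 'M[R[i]]_(m, n)) : 'M[R[i]]_(m, n) :=
  \matrix_(i, j) expectationC P (fun w => A w i j).

Definition outer (R : realType) (d : nat) (x : 'cV[R[i]]_d) : 'M[R[i]]_d :=
  x *m adjmx x.

(* Main.v *)
(* The method of interlacing polynomials of Marcus, Spielman and Srivastava, with
   matrices kept as arguments.  For mixtures [g X = E det (X - sum_i v_i v_i^* )],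
   averaging over one more [v] is [g |-> g - D_A g], [A = E (v v^* )]; it preserves
   stability ([g X <> 0] when [X] has positive definite imaginary part), since the
   roots of [t |-> g (X + t A)] lie below the real axis.  Stability alone makes the
   barrier [D_A g / g] nonincreasing along positive semidefinite directions and,
   above the roots, convex along them: for imaginary [t] the roots of
   [u |-> g (Z + u B + t A)] have negative imaginary part, and for small [t] also
   negative real part, which gives the sign of the logarithmic derivatives term by
   term.  Convexity moves the barrier argument from [(sqrt eps + eps) I] to
   [(1 + sqrt eps)^2 I], above which the fully averaged polynomial is positive.
   Monotonicity along [I] then allows fixing the vectors one by one while staying
   positive on the half-line, so that [(1 + sqrt eps)^2] exceeds all eigenvalues of
   [sum_i v_i v_i^* ] for one outcome, which has positive probability by
   independence. *)

Require Import Defs.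
From HB Require Import structures.
From mathcomp Require Import all_boot all_order all_algebra.
From mathcomp Require Import all_classical all_reals all_analysis.
From mathcomp Require Import complex.
From mathcomp Require Import perm polyrcf ring lra.

Set Implicit Arguments.
Unset Strict Implicit.
Unset Printing Implicit Defensive.

Import Order.TTheory GRing.Theory Num.Theory.
Import numFieldNormedType.Exports.

Local Open Scope classical_set_scope.
Local Open Scope ring_scope.

(** * Root location and bivariate inequalities *)

Section StablePolynomials.
Variable R : rcfType.
Local Notation C := R[i].
Local Notation Re := complex.Re.
Local Notation Im := complex.Im.
Local Notation "x %:C" := (real_complex R x).
Local Notation iC x := (Complex 0 x : C).

(** Linear factorization over an algebraically closed field, packaged as an induction: the root
    region [D] passes to each cofactor [P], so sums over roots can be bounded one term at a time. *)
Lemma poly_root_ind (D : C -> Prop) (Q : {poly C} -> Prop) :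
  (forall c, c != 0 -> Q c%:P) ->
  (forall r P, D r -> P != 0 -> (forall z, root P z -> D z) -> Q P ->
    Q (('X - r%:P) * P)) ->
  forall P, P != 0 -> (forall z, root P z -> D z) -> Q P.
Proof.
move=> Qc QM P P0 DP; have [rs Prs] := closed_field_poly_normal P.
have c0 : lead_coef P != 0 by rewrite lead_coef_eq0.
suff [] : Q P /\ P != 0 by [].
have : forall z, z \in rs -> D z.
  by move=> z zrs; apply: DP; rewrite Prs rootZ // root_prod_XsubC.
rewrite Prs; elim: rs {P P0 DP Prs} (lead_coef P) c0 => [|r rs IH] c c0 Drs.
  by rewrite big_nil alg_polyC polyC_eq0; split => //; apply: Qc.
rewrite big_cons scalerAr.
have [|QP P0] := IH c c0; first by move=> z zrs; apply: Drs; rewrite inE zrs orbT.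
split; last by rewrite mulf_neq0 // polyXsubC_eq0.
apply: QM => //; first by apply: Drs; rewrite inE eqxx.
by move=> z; rewrite rootZ // root_prod_XsubC => zrs; apply: Drs; rewrite inE zrs orbT.
Qed.

Lemma coef_XsubCM (r : C) (P : {poly C}) k :
  (('X - r%:P) * P)`_k.+1 = P`_k - r * P`_k.+1.
Proof. by rewrite mulrBl coefB coefXM mul_polyC coefZ. Qed.

Lemma coef0_XsubCM (r : C) (P : {poly C}) :
  (('X - r%:P) * P)`_0 = - r * P`_0.
Proof. by rewrite mulrBl coefB coefXM mul_polyC coefZ /= sub0r mulNr. Qed.

Lemma Imc_inv (z : C) : Im z^-1 = - Im z / (Re z ^+ 2 + Im z ^+ 2).
Proof. by case: z => a b /=; rewrite mulNr. Qed.

Lemma Imc_sub (x y : C) : Im (x - y) = Im x - Im y.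
Proof. by case: x; case: y. Qed.

Lemma Imc_mul (x y : C) : Im (x * y) = Re x * Im y + Im x * Re y.
Proof. by case: x; case: y. Qed.

Lemma Rec_mul (x y : C) : Re (x * y) = Re x * Re y - Im x * Im y.
Proof. by case: x; case: y. Qed.

(** The quotient is [P'(0) / P(0)], that is [- sum 1 / r] over the roots, and [Im (- 1 / r)] has the
    sign of [Im r]. The first alternative covers constant polynomials. *)
Lemma Im_logderiv (P : {poly C}) : P != 0 ->
  (forall z, root P z -> Im z < 0) -> P`_1 = 0 \/ Im (P`_1 / P`_0) < 0.
Proof.
move=> P0 HP; suff [] : P`_0 != 0 /\ (P`_1 = 0 \/ Im (P`_1 / P`_0) < 0) by [].
move: P P0 HP; apply: poly_root_ind => [c c0|r P ri _ _ [P0 IH]].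
  by rewrite !coefC /=; split => //; left.
have r0 : r != 0 by apply: contraTneq ri => ->; rewrite ltxx.
rewrite coef_XsubCM coef0_XsubCM mulf_neq0 ?oppr_eq0 //; split=> //; right.
have -> : (P`_0 - r * P`_1) / (- r * P`_0) = P`_1 / P`_0 - r^-1.
  by field; rewrite P0 r0.
rewrite Imc_sub Imc_inv mulNr opprK -[ltRHS]addr0 ler_ltD //.
  by case: IH => [->|/ltW //]; rewrite mul0r lexx.
rewrite nmulr_rlt0 // invr_gt0 ltr_pwDr ?sqr_ge0 //.
by rewrite exprn_even_gt0 //= lt_eqF.
Qed.

(** The quotient is the second derivative of [log P] at 0, that is [- sum 1 / r ^ 2] over the roots;
    a root in the open third quadrant has [Im (r ^ 2) > 0]. *)
Lemma Im_deriv2_log (P : {poly C}) : P != 0 ->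
  (forall z, root P z -> Re z < 0 /\ Im z < 0) ->
  0 <= Im ((P`_2 * P`_0 *+ 2 - P`_1 ^+ 2) / P`_0 ^+ 2).
Proof.
move=> P0 HP.
suff [] : P`_0 != 0 /\ 0 <= Im ((P`_2 * P`_0 *+ 2 - P`_1 ^+ 2) / P`_0 ^+ 2) by [].
move: P P0 HP; apply: poly_root_ind => [c c0|r P [rr ri] _ _ [P0 IH]].
  by rewrite !coefC /= !mul0r mul0rn expr0n subr0 mul0r lexx.
have r0 : r != 0 by apply: contraTneq ri => ->; rewrite ltxx.
rewrite !coef_XsubCM coef0_XsubCM mulf_neq0 ?oppr_eq0 //; split=> //.
have -> : ((P`_1 - r * P`_2) * (- r * P`_0) *+ 2 - (P`_0 - r * P`_1) ^+ 2) /
    (- r * P`_0) ^+ 2 = (P`_2 * P`_0 *+ 2 - P`_1 ^+ 2) / P`_0 ^+ 2 - (r ^+ 2)^-1.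
  by field; rewrite P0 r0.
rewrite Imc_sub Imc_inv mulNr opprK addr_ge0 // mulr_ge0 //.
  by rewrite expr2 Imc_mul addr_ge0 // nmulr_lge0 // ltW.
by rewrite invr_ge0 addr_ge0 // sqr_ge0.
Qed.

Lemma lerR_normB (z : C) (r : R) : 0 <= Re z -> r <= 0 ->
  `|z| <= `|z - r%:C| /\ (- r)%:C <= `|z - r%:C|.
Proof.
case: z => a b /= a0 r0; rewrite !normc_def /= !lecR; split.
  by apply: ler_wsqrtr; rewrite subr0 lerD2r; nra.
rewrite -[leLHS]ger0_norm ?oppr_ge0 // -sqrtr_sqr; apply: ler_wsqrtr.
rewrite subr0; nra.
Qed.

(* On the half-plane [0 <= Re z] each factor [`|z - r|], [r < 0], dominates
   both [`|z|] and [- r]. *)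
Lemma norm_horner_lb (P : {poly C}) : P != 0 ->
  (forall z, root P z -> Im z = 0 /\ Re z < 0) ->
  exists2 k : C, 0 < k &
    forall z i, 0 <= Re z -> (i < size P)%N -> k * `|z| ^+ i <= `|P.[z]|.
Proof.
move: P; apply: poly_root_ind => [c c0|r P [ri rr] P0 _ [k k0 IH]].
  exists `|c|; rewrite ?normr_gt0 // => z i _.
  by rewrite size_polyC c0 ltnS leqn0 => /eqP->; rewrite expr0 mulr1 hornerC.
have rE : r = (Re r)%:C by rewrite [LHS]complexE ri mulr0 addr0.
have mr0 : 0 < Num.min 1 (- Re r) by rewrite lt_min ltr01 oppr_gt0.
exists ((Num.min 1 (- Re r))%:C * k); first by rewrite mulr_gt0 // ltcR.
move=> z i z0; rewrite size_mul ?polyXsubC_eq0 // size_XsubC => iP.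
rewrite hornerM hornerXsubC normrM.
have [nz1 nz2] := lerR_normB z0 (ltW rr).
have m1 : (Num.min 1 (- Re r))%:C <= 1 by rewrite (_ : 1 = 1%:C) // lecR ge_min lexx.
have m2 : (Num.min 1 (- Re r))%:C <= (- Re r)%:C by rewrite lecR ge_min lexx orbT.
case: i iP => [|i] iP.
  rewrite expr0 mulr1 rE ler_pM ?(ltW k0) ?ler0c ?(ltW mr0) //.
    exact: le_trans nz2.
  by have := IH z 0%N z0; rewrite expr0 mulr1; apply; rewrite size_poly_gt0.
have -> : (Num.min 1 (- Re r))%:C * k * `|z| ^+ i.+1 =
    ((Num.min 1 (- Re r))%:C * `|z|) * (k * `|z| ^+ i) by rewrite exprS; ring.
have k0' := ltW k0; have mr0' : 0 <= (Num.min 1 (- Re r))%:C by rewrite ler0c ltW.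
apply: ler_pM; [by rewrite mulr_ge0|by rewrite mulr_ge0 ?exprn_ge0| |].
  rewrite rE; apply: le_trans nz1; rewrite -[leRHS]mul1r.
  by apply: ler_wpM2r => //.
exact: IH.
Qed.

Lemma norm_horner_ub (P : {poly C}) :
  exists2 K : C, 0 <= K & forall z, `|z| <= 1 -> `|P.[z]| <= K.
Proof.
elim/poly_ind: P => [|P c [K K0 IH]].
  by exists 0 => // z _; rewrite horner0 normr0.
exists (K + `|c|) => [|z z1]; first by rewrite addr_ge0.
rewrite hornerMXaddC (le_trans (ler_normD _ _)) // lerD2r normrM -[leRHS]mulr1.
by rewrite ler_pM // IH.
Qed.

Lemma real_coef (f : {poly C}) : map_poly conjc f = f -> forall i, Im f`_i = 0.
Proof.
move=> rf i; have /(congr1 (@complex.Im R)) := congr1 (fun p : {poly C} => p`_i) rf.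
by rewrite coef_map; case: (f`_i) => a b /=; lra.
Qed.

(** For small [h] the imaginary part of [f (i h)] is the linear term [f_1 h] up to an error of order
    [h ^ 2]. *)
Lemma real_coef1_ge0 (f : {poly C}) (e : R) : 0 < e -> map_poly conjc f = f ->
  (forall h, 0 < h -> h < e -> 0 <= Im f.[iC h]) -> 0 <= Re f`_1.
Proof.
move=> e0 /real_coef rf Hf; rewrite leNgt; apply/negP => f1.
pose g := drop_poly 2 f; have [K K0 gK] := norm_horner_ub g.
have fE z : f.[z] = g.[z] * z ^+ 2 + (f`_1 * z + f`_0).
  rewrite -[f in LHS](poly_take_drop 2) hornerD hornerM hornerXn addrC.
  congr (_ + _); rewrite horner_poly !big_ord_recr big_ord0 /= add0r.
  by rewrite expr0 mulr1 expr1 addrC.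
have KR : K = (Re K)%:C by rewrite RRe_real // ger0_real.
have rK0 : 0 <= Re K by rewrite -ler0c -KR.
(* With this [h] the remainder, at most [K h ^ 2], is smaller than half of [- f_1 h]. *)
pose h := Num.min (e / 2) (Num.min 1 (- Re f`_1 / (2 * (Re K + 1)))).
have h0 : 0 < h.
  rewrite !lt_min ltr01 divr_gt0 //=; apply: divr_gt0; first by rewrite oppr_gt0.
  by rewrite mulr_gt0 // ltr_wpDl.
have he : h < e by apply: (@le_lt_trans _ _ (e / 2)); [rewrite ge_min lexx|lra].
have h1 : h <= 1 by rewrite !ge_min lexx orbT.
have hK : h * (2 * (Re K + 1)) <= - Re f`_1.
  by rewrite -ler_pdivlMr ?mulr_gt0 ?ltr_wpDl // !ge_min lexx !orbT.
have := Hf h h0 he; rewrite fE.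
have nh : `|iC h| <= 1.
  by rewrite normc_def /= expr0n add0r sqrtr_sqr gtr0_norm // lecR.
have := gK _ nh; move: (g.[_]) => [a b]; rewrite KR normc_def lecR /= => abK.
have bK : - b <= Re K.
  apply: le_trans abK; apply: le_trans (ler_norm _) _; rewrite normrN -sqrtr_sqr.
  by apply: ler_wsqrtr; rewrite lerDr sqr_ge0.
have := rf 1%N; have := rf 0%N; case: (f`_1) f1 hK => u v /= f1 hK.
case: (f`_0) => u0 v0 /= -> -> H.
have {H} : 0 <= h * (u - b * h) by lra.
rewrite pmulr_rge0 // => H.
have : - b * h <= Re K * h by rewrite ler_pM2r.
nra.
Qed.

(** Convention for a bivariate [q]: the outer variable is [u], the inner one [t], and coefficient
    indices come in the order [u], [t]. *)
Definition ev_inner (z : C) (q : {poly {poly C}}) : {poly C} :=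
  map_poly (horner_eval z) q.

Lemma coef_ev_inner z q i : (ev_inner z q)`_i = (q`_i).[z].
Proof. by rewrite coef_map. Qed.

Lemma conj_horner_real (f : {poly C}) (h : R) : map_poly conjc f = f ->
  (f \Po - 'X).[iC h] = (f.[iC h])^*%C.
Proof.
move=> rf; rewrite horner_comp hornerN hornerX -horner_map /= rf.
by rewrite [X in - X]complexE /= rmorph0 add0r; congr (_.[_]); rewrite mulrC /=; simpc.
Qed.

Lemma coef_compN (b : {poly C}) i : (b \Po - 'X)`_i = (-1) ^+ i * b`_i.
Proof.
elim/poly_ind: b i => [|b c IH] i; first by rewrite comp_poly0 coef0 mulr0.
rewrite comp_polyD comp_polyC comp_polyM comp_polyX mulrN !coefD coefN !coefMX !coefC.
case: i => [|i] /=; first by rewrite expr0 oppr0 mul1r.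
by rewrite !addr0 IH exprS; ring.
Qed.

(* As [b.[- i h]] is the conjugate of [b.[i h]], the sign of [Im (a / b)] is that
   of [Im (a * (b \Po - 'X))] at [i h], whose linear term is the Wronskian. *)
Lemma Im_ratio_deriv (a b : {poly C}) (e : R) : 0 < e ->
  map_poly conjc a = a -> map_poly conjc b = b ->
  (forall h, 0 < h -> h < e -> b.[iC h] != 0 /\ 0 <= Im (a.[iC h] / b.[iC h])) ->
  0 <= Re (a`_1 * b`_0 - a`_0 * b`_1).
Proof.
move=> e0 ra rb H.
have -> : a`_1 * b`_0 - a`_0 * b`_1 = (a * (b \Po - 'X))`_1.
  by rewrite coefM !big_ord_recr big_ord0 /= !coef_compN; ring.
apply: (@real_coef1_ge0 _ e) => // [|h h0 he].
  by rewrite rmorphM /= map_comp_poly rmorphN /= map_polyX ra rb.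
rewrite hornerM conj_horner_real //.
have [b0 Hab] := H h h0 he; move: b0 Hab; move: (a.[_]) (b.[_]) => x y y0.
have -> : x * y^*%C = (x / y) * (`|y| ^+ 2) by rewrite sqr_normc; field.
rewrite normc_def; move: (x / y) => z Hz; rewrite -rmorphXn /= Imc_mul /= mulr0 add0r.
by rewrite mulr_ge0 // sqr_ge0.
Qed.

Definition real_biv (q : {poly {poly C}}) := forall i, map_poly conjc q`_i = q`_i.

(** The expression is [q ^ 2] times the mixed second derivative of [log q] at the origin. For
    [t = i h] the roots in [u] lie below the real axis, so the logarithmic derivative in [u] has
    nonpositive imaginary part; its linear term in [h] is the mixed derivative. *)
Lemma biv_mixed_le0 (q : {poly {poly C}}) : real_biv q ->
  (forall h s, 0 < h -> 0 <= Im s -> (ev_inner (iC h) q).[s] != 0) ->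
  Re ((q`_1)`_1 * (q`_0)`_0 - (q`_1)`_0 * (q`_0)`_1) <= 0.
Proof.
move=> rq Hq.
suff : 0 <= Re ((- q`_1)`_1 * (q`_0)`_0 - (- q`_1)`_0 * (q`_0)`_1).
  by rewrite !coefN; move: (_`_1) (_`_0) (_`_1) (_`_0) => [? ?] [? ?] [? ?] [? ?] /=; lra.
apply: (@Im_ratio_deriv _ _ 1) => // [|h h0 _]; first by rewrite rmorphN /= rq.
have P0 : ev_inner (iC h) q != 0.
  by apply: contra (Hq h 0 h0 (lexx _)) => /eqP ->; rewrite horner0.
have P00 : (ev_inner (iC h) q)`_0 != 0 by rewrite -horner_coef0 Hq.
split; first by rewrite -coef_ev_inner.
rewrite hornerN mulNr -!coef_ev_inner.
have [z rz|->|] := Im_logderiv P0; last 2 first.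
- by rewrite mul0r oppr0 lexx.
- by move: (_ / _) => [x y] /= y0; rewrite oppr_ge0 ltW.
by rewrite ltNge; apply: contraTN rz => z0; apply: Hq.
Qed.

(* The roots of [q(., i h)] stay in the left half-plane for small [h], because the
   leading coefficient of [q] in the outer variable is constant. *)
Lemma left_roots_perturb (q : {poly {poly C}}) n :
  (size q <= n.+1)%N -> (q`_n)`_0 != 0 -> (size (q`_n)%R <= 1)%N ->
  (forall z, root (ev_inner 0 q) z -> Im z = 0 /\ Re z < 0) ->
  exists2 e, 0 < e & forall h z, 0 < h -> h < e ->
    root (ev_inner (iC h) q) z -> Re z < 0.
Proof.
move=> sq qn qn1 Hq.
have P0 : ev_inner 0 q != 0.
  apply: contra qn => /eqP E; rewrite -horner_coef0 -coef_ev_inner.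
  by rewrite E coef0.
have sP i : (i < n)%N -> (i < size (ev_inner 0 q)%R)%N.
  move=> lin; apply: (leq_trans lin); apply: ltnW; rewrite ltnNge; apply/negP => /leq_sizeP.
  by move=> /(_ n (leqnn n)); rewrite coef_ev_inner horner_coef0; move/eqP: qn.
have [k k0 kP] := norm_horner_lb P0 Hq.
have [K K0 KP] : exists2 K : C, 0 <= K & forall i z, `|z| <= 1 -> (i < n)%N ->
    `|(q`_i).[z] - (q`_i).[0]| <= K * `|z|.
  elim: n {sP sq qn qn1} => [|n [K K0 IH]]; first by exists 0.
  have [K' K'0 H'] := norm_horner_ub (drop_poly 1 q`_n).
  exists (K + K') => [|i z z1]; first by rewrite addr_ge0.
  rewrite ltnS leq_eqVlt => /orP[/eqP->|lin]; last first.
    by apply: (le_trans (IH i z z1 lin)); rewrite ler_wpM2r // lerDl.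
  have -> : (q`_n).[z] - (q`_n).[0] = (drop_poly 1 q`_n).[z] * z.
    rewrite -[q`_n in LHS](poly_take_drop 1) !hornerD !hornerM !hornerXn expr0n mulr0 addr0.
    rewrite addrAC expr1 !horner_poly !big_ord_recr !big_ord0 /= !expr0 subrr add0r.
    by [].
  by rewrite normrM ler_wpM2r // (le_trans (H' z z1)) // lerDr.
have KR : K = (Re K)%:C by rewrite RRe_real // ger0_real.
have kR : k = (Re k)%:C by rewrite RRe_real // gtr0_real.
have rK0 : 0 <= Re K by rewrite -ler0c -KR.
have rk0 : 0 < Re k by rewrite -ltcR -kR.
have d0 : 0 < Re K * n%:R + 1 by rewrite ltr_wpDl // mulr_ge0.
(* Below this bound [h K n < k], which the final estimate contradicts; [h < 1] keeps [i h] in the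
   unit disc, where [K] is valid. *)
exists (Num.min 1 (Re k / (Re K * n%:R + 1))).
  by rewrite lt_min ltr01 divr_gt0.
move=> h z h0; rewrite lt_min => /andP[h1 hk] rz; rewrite ltNge; apply/negP => z0.
have {}hk : h * (Re K * n%:R) < Re k.
  by move: hk; rewrite ltr_pdivlMr // mulrDr mulr1 => hk; lra.
have hs w : (ev_inner w q).[z] = \sum_(i < n.+1) (q`_i).[w] * z ^+ i.
  rewrite (@horner_coef_wide _ n.+1) ?(leq_trans (size_poly _ _)) //.
  by apply: eq_bigr => i _; rewrite coef_ev_inner.
have nh : `|iC h| = h%:C by rewrite normc_def /= expr0n add0r sqrtr_sqr gtr0_norm.
have E : - (ev_inner 0 q).[z] = \sum_(i < n) ((q`_i).[iC h] - (q`_i).[0]) * z ^+ i.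
  move/rootP: rz => rz; rewrite -sub0r -{1}rz !hs -sumrB big_ord_recr /=.
  rewrite [X in _ + X](_ : _ = 0) ?addr0.
    by apply: eq_bigr => i _; rewrite mulrBl.
  by rewrite (size1_polyC qn1) !hornerC subrr.
have P0z : 0 < `|(ev_inner 0 q).[z]|.
  by rewrite normr_gt0; apply/negP => /Hq[_]; rewrite ltNge z0.
(* For a root [z] of [q(., i h)] in the closed right half-plane, [- q(z, 0)] is a sum of [n] terms
   of size at most [K h |z| ^ i], and [k |z| ^ i <= |q(z, 0)|]. *)
have : k * `|(ev_inner 0 q).[z]| <= (h * (Re K * n%:R))%:C * `|(ev_inner 0 q).[z]|.
  rewrite -normrN {1}E; apply: (@le_trans _ _ (k * \sum_(i < n) K * h%:C * `|z| ^+ i)).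
    rewrite ler_pM2l //; apply: (le_trans (ler_norm_sum _ _ _)).
    apply: ler_sum => i _; rewrite normrM normrX ler_wpM2r ?exprn_ge0 // -nh.
    by apply: KP => //; rewrite nh lecR ltW.
  rewrite normrN mulr_sumr.
  apply: (@le_trans _ _ (\sum_(i < n) K * h%:C * `|(ev_inner 0 q).[z]|)).
    apply: ler_sum => i _; rewrite mulrCA ler_wpM2l ?mulr_ge0 ?ler0c ?(ltW h0) //.
    by apply: kP => //; apply: sP.
  rewrite sumr_const card_ord -mulr_natr KR.
  by rewrite !rmorphM rmorph_nat /= -KR le_eqVlt; apply/orP; left; apply/eqP; ring.
by rewrite ler_pM2r // kR lecR leNgt hk.
Qed.

(* The conclusion is the sign, up to a positive factor, of the derivative in the
   inner variable of [d^2/du^2 (log q)], that is, of [d^2/du^2 (d/dt log q)]; for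
   imaginary [t] each root [r] of [q(., t)] contributes [- 1 / r ^ 2] to it. *)
Lemma biv_convex_ge0 (q : {poly {poly C}}) n : real_biv q ->
  (size q <= n.+1)%N -> (q`_n)`_0 != 0 -> (size (q`_n)%R <= 1)%N ->
  (forall z, root (ev_inner 0 q) z -> Im z = 0 /\ Re z < 0) ->
  (forall h s, 0 < h -> 0 <= Im s -> (ev_inner (iC h) q).[s] != 0) ->
  0 <= Re ((q`_0)`_0 * ((q`_2)`_1 * (q`_0)`_0 ^+ 2 - (q`_2)`_0 * (q`_0)`_1 * (q`_0)`_0
      - (q`_1)`_0 * (q`_1)`_1 * (q`_0)`_0 + (q`_1)`_0 ^+ 2 * (q`_0)`_1)).
Proof.
move=> rq sq qn qn1 Hq0 Hq.
have [e e0 He] := left_roots_perturb sq qn qn1 Hq0.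
(* [a / b] is the second derivative of [log q] in [u] at [u = 0], as a function of [t]. *)
pose a : {poly C} := q`_2 * q`_0 *+ 2 - q`_1 ^+ 2.
pose b : {poly C} := q`_0 ^+ 2.
have ra : map_poly conjc a = a by rewrite rmorphB rmorphMn rmorphM rmorphXn /= !rq.
have rb : map_poly conjc b = b by rewrite rmorphXn /= rq.
have : 0 <= Re (a`_1 * b`_0 - a`_0 * b`_1).
  apply: (Im_ratio_deriv e0 ra rb) => h h0 he.
  have P0 : ev_inner (iC h) q != 0.
    by apply: contra (Hq h 0 h0 (lexx _)) => /eqP ->; rewrite horner0.
  have P00 : (ev_inner (iC h) q)`_0 != 0 by rewrite -horner_coef0 Hq.
  rewrite /a /b !hornerE -!coef_ev_inner expf_neq0 //; split => //.
  apply: Im_deriv2_log => // z rz; split; first exact: (He h).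
  by rewrite ltNge; apply: contraTN rz => z0; rewrite /root Hq.
have a0 : a`_0 = (q`_2)`_0 * (q`_0)`_0 *+ 2 - (q`_1)`_0 ^+ 2.
  by rewrite /a coefB coefMn expr2 !coef0M expr2.
have b0 : b`_0 = (q`_0)`_0 ^+ 2 by rewrite /b expr2 coef0M expr2.
have c1 (f g : {poly C}) : (f * g)`_1 = f`_0 * g`_1 + f`_1 * g`_0.
  by rewrite coefM !big_ord_recr big_ord0 /= add0r.
rewrite a0 b0 /a /b coefB coefMn !expr2 !c1.
set X := (X in Re X); set Y := (Y in _ -> 0 <= Re Y).
have -> : X = Y *+ 2 by rewrite /X /Y; ring.
by rewrite mulr2n; case: Y => x y /=; lra.
Qed.
End StablePolynomials.

(** * Rank-one updates of determinants *)

Section RankOneDet.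

(** The bordered matrix with block rows [(1, - v)] and [(u, M)] has two block-triangular
    factorizations; their determinants agree. *)
Lemma det_rank1_unit (F : fieldType) n (M : 'M[F]_n) (u : 'cV_n) (v : 'rV_n) :
  \det M != 0 -> \det (M + u *m v) = \det M + (v *m \adj M *m u) 0 0.
Proof.
move=> dM; have uM : M \in unitmx by rewrite unitmxE unitfE.
pose P : 'M[F]_(1 + n) := block_mx 1%:M (- v) u M.
have P1 : P = block_mx 1%:M 0 u 1%:M *m block_mx 1%:M (- v) 0 (M + u *m v).
  rewrite mulmx_block !(mul1mx, mul0mx, mulmx0, addr0, add0r, mulmx1) mulmxN.
  by rewrite addrCA addNr addr0.
have P2 : P = block_mx (1%:M + v *m invmx M *m u) (- v) 0 M *m
              block_mx 1%:M 0 (invmx M *m u) 1%:M.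
  rewrite mulmx_block !(mulmx1, mulmx0, mul0mx, add0r).
  by rewrite mulNmx mulmxA addrK mulKVmx.
have := congr1 determinant P1.
rewrite P2 !det_mulmx !det_ublock !det_lblock !det1 !mul1r !mulr1 => <-.
rewrite [\det (1%:M + _)]det_mx11 mxE [X in X + _]mxE eqxx mulrDl mul1r.
congr (_ + _); rewrite /invmx uM -scalemxAr -scalemxAl [X in X * _]mxE.
by rewrite mulrAC mulVf // mul1r.
Qed.

Lemma det_rank1_idom (S : idomainType) n (M : 'M[S]_n) (u : 'cV_n) (v : 'rV_n) :
  \det M != 0 -> \det (M + u *m v) = \det M + (v *m \adj M *m u) 0 0.
Proof.
move=> dM; apply/eqP; rewrite -tofrac_eq; apply/eqP.
rewrite rmorphD -!det_map_mx map_mxD map_mxM det_rank1_unit; last first.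
  by rewrite det_map_mx tofrac_eq0.
by congr (_ + _); rewrite -map_mx_adj -!map_mxM mxE.
Qed.

Lemma det_addX_neq0 (S : idomainType) n (M : 'M[S]_n) :
  \det (map_mx polyC M + 'X%:M) != 0.
Proof.
rewrite (_ : _ + _ = char_poly_mx (- M)) ?monic_neq0 ?char_poly_monic //.
by rewrite /char_poly_mx map_mxN opprK addrC.
Qed.

(** Replacing [M] by [M + X] makes the determinant a nonzero polynomial, so the formula holds there
    by passing to fractions; evaluation at [X = 0] removes the restriction. The generality serves
    matrices over [{poly C}]. *)
Lemma det_rank1 (S : idomainType) n (M : 'M[S]_n) (u : 'cV_n) (v : 'rV_n) :
  \det (M + u *m v) = \det M + (v *m \adj M *m u) 0 0.
Proof.
have := det_rank1_idom (map_mx polyC u) (map_mx polyC v) (det_addX_neq0 M).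
move=> /(congr1 (horner_eval 0)); rewrite rmorphD /= -!det_map_mx.
have E m p (A : 'M[S]_(m, p)) : map_mx (horner_eval 0) (map_mx polyC A) = A.
  by apply/matrixP => i j; rewrite !mxE /horner_eval hornerC.
have EX : map_mx (horner_eval 0) (map_mx polyC M + 'X%:M) = M.
  rewrite map_mxD E map_scalar_mx /= /horner_eval hornerX.
  by rewrite raddf0 addr0.
rewrite map_mxD map_mxM !E EX => ->; congr (_ + _).
have -> : forall N : 'M[{poly S}]_1, horner_eval 0 (N 0 0) = (map_mx (horner_eval 0) N) 0 0.
  by move=> N; symmetry; apply: mxE.
by rewrite !map_mxM map_mx_adj EX !E.
Qed.
End RankOneDet.

(** * Mixtures of determinants *)

Section MixedDeterminant.
Variable d : nat.

(** For weights of total mass 1, this is [E det (X - H)] with [H] of finite support. A general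
    commutative ring lets the entries become polynomials. *)
Definition mixdet (S : comNzRingType) (s : seq (S * 'M[S]_d)) (X : 'M[S]_d) : S :=
  \sum_(aH <- s) aH.1 * \det (X - aH.2).

Definition map_data (S S' : Type) (f : S -> S') (s : seq (S * 'M[S]_d)) :
  seq (S' * 'M[S']_d) := [seq (f aH.1, map_mx f aH.2) | aH <- s].

Lemma mixdet_map (S S' : comNzRingType) (f : {rmorphism S -> S'}) s X :
  f (mixdet s X) = mixdet (map_data f s) (map_mx f X).
Proof.
rewrite /mixdet big_map rmorph_sum /=; apply: eq_bigr => aH _.
by rewrite rmorphM /= -det_map_mx map_mxB.
Qed.

Definition line_mx (S : comNzRingType) (X A : 'M[S]_d) : 'M[{poly S}]_d :=
  map_mx polyC X + 'X *: map_mx polyC A.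

(** The restriction to the line [X + t A], as a polynomial in [t]; its coefficient of [t] is the
    derivative [D_A] at [X]. *)
Definition mixpoly (S : comNzRingType) (s : seq (S * 'M[S]_d)) (X A : 'M[S]_d) :
  {poly S} := mixdet (map_data polyC s) (line_mx X A).

Lemma map_data_comp (S1 S2 S3 : Type) (f : S1 -> S2) (g : S2 -> S3) s :
  map_data g (map_data f s) = map_data (g \o f) s.
Proof.
rewrite /map_data -map_comp; apply: eq_map => aH /=; congr pair.
by apply/matrixP => i j; rewrite !mxE.
Qed.

Lemma eq_map_data (S1 S2 : Type) (f g : S1 -> S2) s : f =1 g ->
  map_data f s = map_data g s.
Proof.
move=> fg; apply: eq_map => aH /=; rewrite fg; congr pair.
by apply/matrixP => i j; rewrite !mxE fg.
Qed.

Lemma map_data_id (S : Type) (f : S -> S) s : f =1 id -> map_data f s = s.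
Proof.
move=> fid; rewrite /map_data (eq_map (g := id)) ?map_id // => -[a H] /=.
by rewrite fid; congr pair; apply/matrixP => i j; rewrite !mxE fid.
Qed.

Lemma mixpoly_map (S S' : comNzRingType) (f : {rmorphism S -> S'}) s X A :
  map_poly f (mixpoly s X A) = mixpoly (map_data f s) (map_mx f X) (map_mx f A).
Proof.
rewrite /mixpoly mixdet_map !map_data_comp /line_mx; congr mixdet.
  by apply: eq_map_data => x /=; rewrite map_polyC.
by apply/matrixP => i j; rewrite !mxE rmorphD rmorphM /= !map_polyC map_polyX.
Qed.

Lemma horner_mixpoly (S : comNzRingType) (s : seq (S * 'M[S]_d)) X A (t : S) :
  (mixpoly s X A).[t] = mixdet s (X + t *: A).
Proof.
rewrite -[LHS]/(horner_eval t (mixpoly s X A)) mixdet_map map_data_comp.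
rewrite map_data_id => [|x /=]; last by rewrite /horner_eval hornerC.
by congr mixdet; apply/matrixP => i j; rewrite !mxE /= horner_evalE !hornerE.
Qed.

(* This is [mixdet s (Z + u B + t A)]: the direction [B] of the outer variable [u]
   comes last. *)
Definition mixbiv (S : comNzRingType) (s : seq (S * 'M[S]_d)) (Z A B : 'M[S]_d) :
  {poly {poly S}} :=
  mixpoly (map_data polyC s) (line_mx Z A) (map_mx polyC B).

Lemma mixbiv_map (S S' : comNzRingType) (f : {rmorphism S -> S'}) s Z A B :
  map_poly (map_poly f) (mixbiv s Z A B) =
  mixbiv (map_data f s) (map_mx f Z) (map_mx f A) (map_mx f B).
Proof.
rewrite /mixbiv mixpoly_map !map_data_comp; congr mixpoly.
- by apply: eq_map_data => x /=; rewrite map_polyC.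
- by apply/matrixP => i j; rewrite !mxE rmorphD rmorphM /= !map_polyC map_polyX.
- by apply/matrixP => i j; rewrite !mxE /= map_polyC.
Qed.

Lemma mixbiv_coef0 (S : comNzRingType) (s : seq (S * 'M[S]_d)) Z A B :
  (mixbiv s Z A B)`_0 = mixpoly s Z A.
Proof. by rewrite -horner_coef0 horner_mixpoly scale0r addr0. Qed.

Lemma mixpoly_shift (S : comNzRingType) (s : seq (S * 'M[S]_d)) X A (x : S) :
  mixpoly s (X + x *: A) A = mixpoly s X A \Po ('X + x%:P).
Proof.
rewrite -[RHS]/(comp_poly ('X + x%:P) _) [RHS]mixdet_map map_data_comp; congr mixdet.
  by apply: eq_map_data => y; symmetry; apply: comp_polyC.
apply/matrixP => j k; rewrite !mxE.
rewrite -[RHS]/(((X j k)%:P + 'X * (A j k)%:P) \Po ('X + x%:P)).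
rewrite comp_polyD comp_polyM !comp_polyC comp_polyX.
by rewrite polyCD polyCM mulrDl -addrA [_ * _ + _]addrC.
Qed.

Lemma mixbiv_shift (S : comNzRingType) (s : seq (S * 'M[S]_d)) Z A B (x : S) :
  mixbiv s (Z + x *: B) A B = mixbiv s Z A B \Po ('X + x%:P%:P).
Proof.
rewrite /mixbiv.
have -> : line_mx (Z + x *: B) A = line_mx Z A + x%:P *: map_mx polyC B.
  by apply/matrixP => j k; rewrite !mxE polyCD polyCM addrAC.
exact: mixpoly_shift.
Qed.

Lemma coef_prod_linear (S : comNzRingType) I (r : seq I) (f g : I -> S) :
  (size (\prod_(i <- r) ((f i)%:P + 'X * (g i)%:P))%R <= (size r).+1)%N /\
  (\prod_(i <- r) ((f i)%:P + 'X * (g i)%:P))`_(size r) = \prod_(i <- r) g i.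
Proof.
elim: r => [|i r [IHs IHc]]; first by rewrite !big_nil size_poly1 coefC.
rewrite !big_cons /=; set P := \prod_(j <- r) _ in IHs IHc *.
rewrite mulrDl -mulrA; split.
  apply: (leq_trans (size_polyD _ _)); rewrite geq_max !mul_polyC; apply/andP; split.
    by apply: (leq_trans (size_scale_leq _ _)); apply: leqW.
  rewrite mulrC; apply: (leq_trans (size_polyMleq _ _)); rewrite size_polyX addn2 /= ltnS.
  exact: leq_trans (size_scale_leq _ _) IHs.
by rewrite coefD !mul_polyC coefZ coefXM /= coefZ IHc nth_default // mulr0 add0r.
Qed.

(** Only [t A] contributes to [t ^ d], so the top coefficient depends neither on [X] nor on the
    matrices in [s]. In [mixbiv] this makes it constant in the inner variable. *)
Lemma mixpoly_lead (S : comNzRingType) (s : seq (S * 'M[S]_d)) X A :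
  (size (mixpoly s X A)%R <= d.+1)%N /\
  (mixpoly s X A)`_d = (\sum_(aH <- s) aH.1) * \det A.
Proof.
have H (M : 'M[S]_d) : (size (\det (line_mx X A - map_mx polyC M))%R <= d.+1)%N /\
    (\det (line_mx X A - map_mx polyC M))`_d = \det A.
  have E sg : \prod_i (line_mx X A - map_mx polyC M) i (sg i) =
     \prod_(i <- enum 'I_d) (((X - M) i (sg i))%:P + 'X * (A i (sg i))%:P).
    rewrite big_enum /=; apply: eq_bigr => i _.
    by rewrite !mxE polyCB addrAC.
  rewrite /determinant; split.
    apply: (leq_trans (size_sum _ _ _)); apply/bigmax_leqP => sg _; rewrite E.
    have [] := coef_prod_linear (enum 'I_d) (fun i => (X - M) i (sg i)) (fun i => A i (sg i)).
    rewrite size_enum_ord => Hs _; case: (odd_perm sg); rewrite ?expr0 ?mul1r //.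
    by rewrite expr1 mulN1r size_polyN.
  rewrite coef_sum; apply: eq_bigr => sg _; rewrite E.
  have [] := coef_prod_linear (enum 'I_d) (fun i => (X - M) i (sg i)) (fun i => A i (sg i)).
  rewrite size_enum_ord => _; rewrite [in RHS]big_enum => /= Hc.
  by case: (odd_perm sg); rewrite ?expr0 ?mul1r // !expr1 !mulN1r coefN Hc.
rewrite /mixpoly /mixdet big_map; split.
  apply: (leq_trans (size_sum _ _ _)); elim/big_ind: _ => // [m n hm hn|aH _].
    by rewrite geq_max hm.
  rewrite mul_polyC; apply: leq_trans (size_scale_leq _ _) (proj1 (H _)).
rewrite coef_sum mulr_suml; apply: eq_bigr => aH _ /=.
by rewrite mul_polyC coefZ (proj2 (H _)).
Qed.

End MixedDeterminant.

(** * Monotonicity and convexity of real rational functions *)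

Section RationalFunctions.
Variable R : realType.
Implicit Types N Q : {poly R}.

Definition wronskian N Q : {poly R} := N^`() * Q - N * Q^`().

Lemma ratio_is_derive N Q (x : R) : Q.[x] != 0 ->
  is_derive x (1 : R) (fun y => N.[y] / Q.[y]) ((wronskian N Q).[x] / Q.[x] ^+ 2).
Proof.
move=> Qx.
have dM := is_deriveM (is_derive_poly N x) (is_deriveV Qx (is_derive_poly Q x)).
apply: (is_derive_eq dM).
rewrite /wronskian !hornerE /GRing.scale /=.
by field.
Qed.

Lemma ratio_mvt N Q (a b : R) : a < b -> (forall x, a <= x <= b -> 0 < Q.[x]) ->
  exists2 c, a <= c <= b &
    N.[b] / Q.[b] - N.[a] / Q.[a] = (wronskian N Q).[c] / Q.[c] ^+ 2 * (b - a).
Proof.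
move=> ab Qab.
have dR x : a <= x <= b ->
    is_derive x (1 : R) (fun y => N.[y] / Q.[y]) ((wronskian N Q).[x] / Q.[x] ^+ 2).
  by move=> /Qab Qx; apply: ratio_is_derive; rewrite gt_eqF.
have [x||c cab E] := @MVT R (fun y => N.[y] / Q.[y])
  (fun x => (wronskian N Q).[x] / Q.[x] ^+ 2) a b ab.
- by rewrite in_itv /= => /andP[/ltW ax /ltW xb]; apply: dR; rewrite ax.
- apply: derivable_within_continuous => x; rewrite in_itv /= => xab.
  by have [] := dR x xab.
by exists c => //; move: cab; rewrite in_itv /= => /andP[/ltW -> /ltW ->].
Qed.

Lemma ratio_noninc N Q (a b : R) : a <= b -> (forall x, a <= x <= b -> 0 < Q.[x]) ->
  (forall x, a <= x <= b -> (wronskian N Q).[x] <= 0) ->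
  N.[b] / Q.[b] <= N.[a] / Q.[a].
Proof.
rewrite le_eqVlt => /orP[/eqP-> //|ab] Q0 W0.
have [c cab E] := ratio_mvt N ab Q0.
rewrite -subr_le0 E pmulr_lle0 ?subr_gt0 // pmulr_lle0 ?W0 //.
by rewrite invr_gt0 exprn_gt0 // Q0.
Qed.

(** The double Wronskian is the numerator of the second derivative, so the slope of [N / Q] at an
    intermediate point is at most its slope at [b]. *)
Lemma ratio_tangent N Q (a b : R) : a <= b -> (forall x, a <= x <= b -> 0 < Q.[x]) ->
  (forall x, a <= x <= b -> 0 <= (wronskian (wronskian N Q) (Q ^+ 2)).[x]) ->
  N.[b] / Q.[b] - N.[a] / Q.[a] <= (wronskian N Q).[b] / Q.[b] ^+ 2 * (b - a).
Proof.
rewrite le_eqVlt => /orP[/eqP->|ab] Q0 W0; first by rewrite !subrr mulr0.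
have [c /andP[ac cb] ->] := ratio_mvt N ab Q0.
rewrite ler_pM2r ?subr_gt0 // -!horner_exp.
have Hc x : c <= x <= b -> a <= x <= b.
  by move=> /andP[cx ->]; rewrite (le_trans ac).
have := @ratio_noninc (- wronskian N Q) (Q ^+ 2) c b cb.
rewrite !hornerN !mulNr lerN2; apply => x /Hc xab.
  by rewrite horner_exp exprn_gt0 // Q0.
rewrite (_ : wronskian _ _ = - wronskian (wronskian N Q) (Q ^+ 2)).
  by rewrite hornerN oppr_le0 W0.
by rewrite /wronskian derivN !mulNr opprB addrC opprK.
Qed.

Lemma horner_wronskian2 N Q (x : R) :
  (wronskian (wronskian N Q) (Q ^+ 2)).[x] =
  Q.[x] * (N^`()^`().[x] * Q.[x] ^+ 2 - Q^`()^`().[x] * N.[x] * Q.[x]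
    - 2 * Q^`().[x] * N^`().[x] * Q.[x] + 2 * Q^`().[x] ^+ 2 * N.[x]).
Proof.
rewrite /wronskian [Q ^+ 2]expr2 derivB !derivM !hornerE /=; ring.
Qed.
End RationalFunctions.

(** * Positive matrices, and stability under averaging *)

Section StableMixtures.
Variables (R : realType) (d : nat).
Local Notation C := R[i].
Local Notation Re := complex.Re.
Local Notation Im := complex.Im.
Local Notation "x %:C" := (real_complex R x).
Implicit Types (X Y Z A B M : 'M[C]_d) (x w : 'cV[C]_d) (s : seq (C * 'M[C]_d)).

Lemma map_mx_conj m n (M : 'M[C]_(m, n)) : map_mx conjc M^T = adjmx M.
Proof. by apply/matrixP => i j; rewrite !mxE. Qed.

Lemma adjmxK m n : cancel (@adjmx R m n) (@adjmx R n m).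
Proof. by move=> M; apply/matrixP => i j; rewrite !mxE conjCK. Qed.

Lemma adjmxM m n p (M : 'M[C]_(m, n)) (N : 'M[C]_(n, p)) :
  adjmx (M *m N) = adjmx N *m adjmx M.
Proof. by rewrite /adjmx trmx_mul map_mxM. Qed.

Lemma adjmxD m n (M N : 'M[C]_(m, n)) : adjmx (M + N) = adjmx M + adjmx N.
Proof. by rewrite /adjmx linearD map_mxD. Qed.

Lemma adjmxN m n (M : 'M[C]_(m, n)) : adjmx (- M) = - adjmx M.
Proof. by rewrite /adjmx linearN map_mxN. Qed.

Lemma adjmxZ m n (c : C) (M : 'M[C]_(m, n)) : adjmx (c *: M) = c^*%C *: adjmx M.
Proof. by apply/matrixP => i j; rewrite !mxE rmorphM. Qed.

Lemma adjmxZR m n (c : R) (M : 'M[C]_(m, n)) : adjmx (c%:C *: M) = c%:C *: adjmx M.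
Proof. by rewrite adjmxZ conjc_real. Qed.

Lemma adjmx1 : adjmx (1%:M : 'M[C]_d) = 1%:M.
Proof. by rewrite /adjmx trmx1 map_mx1. Qed.

Lemma adjmx_outer w : adjmx (outer w) = outer w.
Proof. by rewrite /outer adjmxM adjmxK. Qed.

Definition qform X x : C := (adjmx x *m X *m x) 0 0.

Lemma qformD X Y x : qform (X + Y) x = qform X x + qform Y x.
Proof. by rewrite /qform mulmxDr mulmxDl mxE. Qed.

Lemma qformZ (c : C) X x : qform (c *: X) x = c * qform X x.
Proof. by rewrite /qform -scalemxAr -scalemxAl mxE. Qed.

Lemma qform_herm X x : adjmx X = X -> Im (qform X x) = 0.
Proof.
move=> hX; have : (qform X x)^*%C = qform X x.
  rewrite /qform; transitivity (adjmx (adjmx x *m X *m x) 0 0); first by rewrite !mxE.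
  by rewrite !adjmxM adjmxK hX mulmxA.
by case: (qform X x) => a b [] /=; lra.
Qed.

Lemma qform_outer_ge0 w x : 0 <= qform (outer w) x.
Proof.
rewrite /qform /outer mulmxA -mulmxA; set u := adjmx w *m x.
have -> : adjmx x *m w = adjmx u by rewrite adjmxM adjmxK.
rewrite mxE; apply: sumr_ge0 => i _; rewrite [adjmx u _ _]mxE [u^T _ _]mxE mulrC.
exact: mul_conjC_ge0.
Qed.

Lemma qform1_gt0 x : x != 0 -> 0 < qform 1%:M x.
Proof.
move=> x0; rewrite /qform mulmx1 mxE.
have [i xi] : exists i, x i 0 != 0.
  apply/existsP; apply: contraNT x0 => /existsPn H; apply/eqP/matrixP => i j.
  by rewrite (ord1 j) mxE; move/negbNE/eqP: (H i).
have H j : 0 <= adjmx x 0 j * x j 0.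
  by rewrite !mxE mulrC mul_conjC_ge0.
rewrite lt_def sumr_ge0 ?andbT => [|j _]; last exact: H.
apply/eqP => /eqP; rewrite psumr_eq0 => [/allP /(_ i)|j _]; last exact: H.
by rewrite mem_index_enum /= !mxE mulrC mul_conjC_eq0 (negbTE xi) => /(_ isT).
Qed.

Definition psd X := adjmx X = X /\ forall x, 0 <= qform X x.
Definition pd X := adjmx X = X /\ forall x, x != 0 -> 0 < qform X x.
(** The matrix upper half-space: the Hermitian matrix [(X - adjmx X) / 2i] is positive definite. *)
Definition im_pos X := forall x, x != 0 -> 0 < Im (qform X x).

Lemma psd_outer w : psd (outer w).
Proof. by split; [exact: adjmx_outer | exact: qform_outer_ge0]. Qed.

Lemma psd0 : psd 0.
Proof.
split; first by apply/matrixP => i j; rewrite !mxE conjC0.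
by move=> x; rewrite /qform mulmx0 mul0mx mxE.
Qed.

Lemma psdD X Y : psd X -> psd Y -> psd (X + Y).
Proof.
move=> [hX pX] [hY pY]; split; first by rewrite adjmxD hX hY.
by move=> x; rewrite qformD addr_ge0.
Qed.

Lemma psdZ (r : R) X : 0 <= r -> psd X -> psd (r%:C *: X).
Proof.
move=> r0 [hX pX]; split; first by rewrite adjmxZR hX.
by move=> x; rewrite qformZ mulr_ge0 ?ler0c.
Qed.

Lemma pd1 : pd 1%:M.
Proof. by split; [exact: adjmx1 | exact: qform1_gt0]. Qed.

Lemma psd1 : psd 1%:M.
Proof.
split; first exact: adjmx1.
move=> x; have [->|/qform1_gt0/ltW//] := eqVneq x 0.
by rewrite /qform mulmx0 mxE.
Qed.

Lemma pdD X Y : psd X -> pd Y -> pd (X + Y).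
Proof.
move=> [hX pX] [hY pY]; split; first by rewrite adjmxD hX hY.
by move=> x x0; rewrite qformD ltr_wpDl // pY.
Qed.

Lemma pdZ (r : R) X : 0 < r -> pd X -> pd (r%:C *: X).
Proof.
move=> r0 [hX pX]; split; first by rewrite adjmxZR hX.
by move=> x x0; rewrite qformZ mulr_gt0 ?pX // ltcR.
Qed.

Lemma psd_of_pd X : pd X -> psd X.
Proof.
move=> [hX pX]; split=> // x; have [->|/pX/ltW//] := eqVneq x 0.
by rewrite /qform mulmx0 mxE.
Qed.

Lemma det_neq0_qform X : (forall x, x != 0 -> qform X x != 0) -> \det X != 0.
Proof.
move=> HX; apply/det0P => -[v v0 vX].
have /HX : adjmx v != 0.
  apply: contraNneq v0 => E; rewrite -[v]adjmxK E.
  by apply/eqP/matrixP => i j; rewrite !mxE conjC0.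
by rewrite /qform adjmxK vX mul0mx mxE eqxx.
Qed.

Lemma det_im_pos X : im_pos X -> \det X != 0.
Proof.
move=> HX; apply: det_neq0_qform => x /HX.
by apply: contraTneq => ->; rewrite ltxx.
Qed.

Lemma det_pd X : pd X -> \det X != 0.
Proof. by move=> [_ HX]; apply: det_neq0_qform => x /HX /gt_eqF ->. Qed.

Lemma Re_gt0 (z : C) : 0 < z -> 0 < Re z /\ Im z = 0.
Proof. by rewrite ltcE /= => /andP[/eqP -> ->]. Qed.

Lemma Re_ge0 (z : C) : 0 <= z -> 0 <= Re z /\ Im z = 0.
Proof. by rewrite lecE /= => /andP[/eqP -> ->]. Qed.

Lemma im_pos_addZ X A (z : C) : im_pos X -> psd A -> 0 <= Im z -> im_pos (X + z *: A).
Proof.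
move=> HX [_ pA] z0 x /HX Hx; rewrite qformD qformZ raddfD /= Imc_mul.
have [r0 ->] := Re_ge0 (pA x).
by rewrite mulr0 add0r ltr_wpDr // mulr_ge0.
Qed.

Definition outer_avg (L : seq (R * 'cV[C]_d)) : 'M[C]_d :=
  \sum_(pw <- L) pw.1%:C *: outer pw.2.

Lemma psd_outer_avg (L : seq (R * 'cV[C]_d)) :
  (forall pw, pw \in L -> 0 <= pw.1) -> psd (outer_avg L).
Proof.
rewrite /outer_avg; elim: L => [|pw L IH] HL; first by rewrite big_nil; apply: psd0.
rewrite big_cons; apply: psdD.
  by apply: psdZ (psd_outer _); apply: HL; rewrite inE eqxx.
by apply: IH => q qL; apply: HL; rewrite inE qL orbT.
Qed.

(** Jacobi's formula, with the trace of [\adj M *m A] split over the rank-one terms of [A]. By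
    [det_rank1], adding a term contributes [t p qform (\adj (M + t A)) w], whose linear coefficient
    takes the adjugate at [t = 0]. *)
Lemma coef1_det_line M (L : seq (R * 'cV[C]_d)) :
  (\det (line_mx M (outer_avg L)))`_1 =
  \sum_(pw <- L) pw.1%:C * qform (\adj M) pw.2.
Proof.
rewrite /outer_avg; elim: L => [|[p w] L IH].
  rewrite !big_nil /line_mx map_mx0 scaler0 addr0 det_map_mx coefC.
  by [].
rewrite !big_cons /=; set A := \sum_(j <- L) _ in IH *.
have -> : line_mx M (p%:C *: outer w + A) = line_mx M A +
    ('X * p%:C%:P *: map_mx polyC w) *m map_mx polyC (adjmx w).
  rewrite -scalemxAl -map_mxM -/(outer w) /line_mx map_mxD scalerDr.
  by rewrite [_ + 'X *: map_mx polyC A]addrC addrA map_mxZ scalerA.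
rewrite det_rank1 coefD IH addrC; congr (_ + _).
rewrite -scalemxAr mxE -mulrA coefXM /= coefCM; congr (_ * _).
rewrite -horner_coef0 -horner_evalE.
have -> : forall N : 'M[{poly C}]_1, horner_eval 0 (N 0 0) = (map_mx (horner_eval 0) N) 0 0 :> C.
  by move=> N; symmetry; apply: mxE.
have E m n (N : 'M[C]_(m, n)) : map_mx (horner_eval 0) (map_mx polyC N) = N.
  by apply/matrixP => i j; rewrite !mxE /horner_eval hornerC.
rewrite !map_mxM map_mx_adj !E /qform /line_mx map_mxD E.
have -> : map_mx (horner_eval 0) ('X *: map_mx polyC A) = 0.
  by apply/matrixP => i j; rewrite !mxE /= horner_evalE !hornerE.
by rewrite addr0.
Qed.

Definition herm_data s := forall aH, aH \in s -> Im aH.1 = 0 /\ adjmx aH.2 = aH.2.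

Definition stable s := forall X, im_pos X -> mixdet s X != 0.

(** Hermitian data make the coefficients real along Hermitian lines, and mass one fixes the leading
    coefficients. *)
Record mixture s : Prop := Mixture {
  mixture_stable : stable s;
  mixture_herm : herm_data s;
  mixture_mass : \sum_(aH <- s) aH.1 = 1 }.

Definition mix_step (L : seq (R * 'cV[C]_d)) s : seq (C * 'M[C]_d) :=
  [seq (aH.1 * pw.1%:C, aH.2 + outer pw.2) | aH <- s, pw <- L].

Lemma mixdet_stepE (L : seq (R * 'cV[C]_d)) s X :
  mixdet (mix_step L s) X = \sum_(pw <- L) pw.1%:C * mixdet s (X - outer pw.2).
Proof.
rewrite /mixdet big_allpairs_dep /= exchange_big /=; apply: eq_bigr => pw _.
rewrite mulr_sumr; apply: eq_bigr => aH _; rewrite opprD addrA addrAC; ring.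
Qed.

Lemma coef1_mixpoly (L : seq (R * 'cV[C]_d)) s X :
  (mixpoly s X (outer_avg L))`_1 =
  \sum_(pw <- L) pw.1%:C * (mixdet s X - mixdet s (X - outer pw.2)).
Proof.
rewrite /mixpoly {1}/mixdet big_map coef_sum /=.
under eq_bigr => aH _.
  rewrite coefCM.
  have -> : line_mx X (outer_avg L) - map_mx polyC aH.2 = line_mx (X - aH.2) (outer_avg L).
    by rewrite /line_mx map_mxB addrAC.
  rewrite coef1_det_line mulr_sumr.
  over.
rewrite exchange_big /=; apply: eq_bigr => pw _.
rewrite /mixdet -sumrB mulr_sumr; apply: eq_bigr => aH _.
rewrite -mulrBr mulrCA; congr (_ * (_ * _)).
rewrite addrAC [X in _ - \det X](_ : _ = (X - aH.2) + (- pw.2) *m adjmx pw.2); last first.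
  by rewrite mulNmx.
rewrite det_rank1 opprD addrA subrr add0r mulmxN mxE opprK.
by [].
Qed.

(* Mixing over [v v^* ] is the operator [1 - D_A], [A = E (v v^* )], because the
   determinant is affine in rank-one directions. *)
Lemma mixdet_step_deriv (L : seq (R * 'cV[C]_d)) s X : \sum_(pw <- L) pw.1 = 1 ->
  mixdet (mix_step L s) X = mixdet s X - (mixpoly s X (outer_avg L))`_1.
Proof.
move=> L1; rewrite mixdet_stepE coef1_mixpoly.
under [in RHS]eq_bigr do rewrite mulrBr.
have L1C : \sum_(pw <- L) pw.1%:C = 1 by rewrite -(rmorph_sum (real_complex R)) L1.
rewrite sumrB [X in _ = _ - (X - _)](_ : _ = mixdet s X) ?subKr //.
by rewrite -mulr_suml L1C mul1r.
Qed.

Lemma mixbiv_eval s Z A B (t : C) :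
  ev_inner t (mixbiv s Z A B) = mixpoly s (Z + t *: A) B.
Proof.
rewrite [LHS]mixpoly_map map_data_comp map_data_id => [|x /=]; last first.
  by rewrite /horner_eval hornerC.
have -> : map_mx (horner_eval t) (line_mx Z A) = Z + t *: A.
  by apply/matrixP => i j; rewrite !mxE /= horner_evalE !hornerE.
have -> // : map_mx (horner_eval t) (map_mx polyC B) = B.
by apply/matrixP => i j; rewrite !mxE /= horner_evalE hornerC.
Qed.

Lemma poly_funext (p q : {poly C}) : (forall t, p.[t] = q.[t]) -> p = q.
Proof.
move=> pq; apply/eqP; rewrite -subr_eq0; apply/eqP.
pose rs : seq C := [seq i%:R | i <- iota 0 (size (p - q))].
apply: (@roots_geq_poly_eq0 _ _ rs); last by rewrite size_map size_iota.
  by apply/allP => z _; rewrite /root !hornerE pq subrr.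
rewrite map_inj_in_uniq ?iota_uniq // => i j _ _ /eqP.
by rewrite eqr_nat => /eqP.
Qed.

(** Both sides agree at every [t], where the step is [1 - D_B] with [B = outer_avg L]. Barriers
    after a step are thus read off the bivariate polynomial before it. *)
Lemma mixpoly_step (L : seq (R * 'cV[C]_d)) s Z A : \sum_(pw <- L) pw.1 = 1 ->
  mixpoly (mix_step L s) Z A =
  (mixbiv s Z A (outer_avg L))`_0 - (mixbiv s Z A (outer_avg L))`_1.
Proof.
move=> L1; apply: poly_funext => t.
rewrite horner_mixpoly mixdet_step_deriv // hornerD hornerN -!coef_ev_inner.
by rewrite mixbiv_eval -[X in _ = X - _]horner_coef0 horner_mixpoly scale0r addr0.
Qed.

(** The entrywise conjugate of a Hermitian matrix is its transpose, and transposition preserves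
    determinants: hence the coefficients of [mixbiv] are real. *)
Definition tr_data (S : Type) (s : seq (S * 'M[S]_d)) := [seq (aH.1, aH.2^T) | aH <- s].

Lemma map_data_herm s : herm_data s ->
  map_data conjc s = tr_data s.
Proof.
move=> hs; apply/eq_in_map => -[a H] /hs /= [ra hH]; congr pair.
  by move: ra; case: a {hs} => x y /= ->; rewrite oppr0.
by rewrite -[in LHS]hH -map_mx_conj; apply/matrixP => i j; rewrite !mxE conjcK.
Qed.

Lemma map_mx_herm M : adjmx M = M -> map_mx conjc M = M^T.
Proof.
by move=> hM; rewrite -[in LHS]hM -map_mx_conj; apply/matrixP => i j; rewrite !mxE conjcK.
Qed.

Lemma mixdet_tr (S : comNzRingType) (s : seq (S * 'M[S]_d)) (X : 'M[S]_d) :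
  mixdet (tr_data s) X^T = mixdet s X.
Proof.
rewrite /mixdet big_map; apply: eq_bigr => aH _ /=.
by rewrite -linearB /= det_tr.
Qed.

Lemma map_tr_data (S S' : Type) (f : S -> S') (s : seq (S * 'M[S]_d)) :
  map_data f (tr_data s) = tr_data (map_data f s).
Proof.
rewrite /map_data /tr_data -!map_comp; apply: eq_map => aH /=; congr pair.
by apply/matrixP => j k; rewrite !mxE.
Qed.

Lemma line_mx_tr (S : comNzRingType) (X A : 'M[S]_d) :
  line_mx X^T A^T = (line_mx X A)^T.
Proof. by apply/matrixP => j k; rewrite !mxE. Qed.

Lemma mixpoly_tr (S : comNzRingType) (s : seq (S * 'M[S]_d)) (X A : 'M[S]_d) :
  mixpoly (tr_data s) X^T A^T = mixpoly s X A.
Proof. by rewrite /mixpoly map_tr_data line_mx_tr mixdet_tr. Qed.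

Lemma mixbiv_tr (S : comNzRingType) (s : seq (S * 'M[S]_d)) (Z A B : 'M[S]_d) :
  mixbiv (tr_data s) Z^T A^T B^T = mixbiv s Z A B.
Proof. by rewrite /mixbiv map_tr_data line_mx_tr -map_trmx mixpoly_tr. Qed.

Lemma mixbiv_real s Z A B : herm_data s -> adjmx Z = Z -> adjmx A = A ->
  adjmx B = B -> real_biv (mixbiv s Z A B).
Proof.
move=> hs hZ hA hB i.
have E : map_poly (map_poly conjc) (mixbiv s Z A B) = mixbiv s Z A B.
  rewrite [LHS]mixbiv_map (map_data_herm hs) (map_mx_herm hZ) (map_mx_herm hA).
  by rewrite (map_mx_herm hB) mixbiv_tr.
by rewrite -[in RHS]E [RHS]coef_map.
Qed.

Lemma mixpoly_neq0 s X A : mixdet s X != 0 -> mixpoly s X A != 0.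
Proof.
apply: contraNneq => E; rewrite -[X]addr0 -(scale0r A) -horner_mixpoly E.
by rewrite horner0.
Qed.

(** A zero of [g - D_A g] at [X] would make the logarithmic derivative of [g (X + t A)] at [t = 0]
    equal to 1. By stability all roots in [t] have negative imaginary part, so a nonzero logarithmic
    derivative is not real. *)
Lemma mix_step_stable (L : seq (R * 'cV[C]_d)) s :
  (forall pw, pw \in L -> 0 <= pw.1) -> \sum_(pw <- L) pw.1 = 1 ->
  stable s -> stable (mix_step L s).
Proof.
move=> L0 L1 st X HX; rewrite mixdet_step_deriv //.
have X0 := st X HX; have P0 := mixpoly_neq0 (outer_avg L) X0.
have pA := psd_outer_avg L0.
have E : (mixpoly s X (outer_avg L))`_0 = mixdet s X.
  by rewrite -horner_coef0 horner_mixpoly scale0r addr0.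
case: (Im_logderiv P0) => [z|->|]; last 2 first.
- by rewrite subr0.
- apply: contraTneq => /eqP; rewrite subr_eq0 E => /eqP <-.
  by rewrite divff //= ltxx.
rewrite /root horner_mixpoly ltNge; apply: contraTN => z0.
exact/st/im_pos_addZ.
Qed.

Lemma mixture_step (L : seq (R * 'cV[C]_d)) s :
  (forall pw, pw \in L -> 0 <= pw.1) -> \sum_(pw <- L) pw.1 = 1 ->
  mixture s -> mixture (mix_step L s).
Proof.
move=> L0 L1 [st hs ms]; split; first exact: mix_step_stable.
- move=> aH /allpairsP[[[a H] [p w]] /= [/hs/= [ra hH] _ ->]] /=.
  by rewrite adjmxD hH adjmx_outer Imc_mul /= ra mulr0 mul0r addr0.
- rewrite big_allpairs_dep /=.
  have L1C : \sum_(pw <- L) pw.1%:C = 1 by rewrite -(rmorph_sum (real_complex R)) L1.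
  by under eq_bigr do rewrite -mulr_sumr L1C mulr1.
Qed.

Lemma mixture_det : mixture [:: (1, 0)].
Proof.
have E X : mixdet [:: (1, 0)] X = \det X by rewrite /mixdet big_seq1 /= mul1r subr0.
split=> [X HX|aH|]; first by rewrite E det_im_pos.
  by rewrite inE => /eqP -> /=; rewrite /adjmx trmx0 map_mx0.
by rewrite big_seq1.
Qed.

End StableMixtures.

(** * Barrier functions *)

Section BarrierRatio.
Variables (R : realType) (d : nat).
Local Notation C := R[i].
Local Notation Re := complex.Re.
Local Notation Im := complex.Im.
Local Notation "x %:C" := (real_complex R x).
Local Notation iC x := (Complex 0 x : C).
Implicit Types (X Y Z A B M : 'M[C]_d) (s : seq (C * 'M[C]_d)).

Lemma Re_horner_ge0 (f : {poly C}) :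
  (forall t : R, 0 < t -> 0 <= Re f.[t%:C]) -> 0 <= Re f.[0].
Proof.
move=> Hf; rewrite leNgt; apply/negP => f0.
have [K K0 gK] := norm_horner_ub (drop_poly 1 f).
have fE z : f.[z] = (drop_poly 1 f).[z] * z + f.[0].
  rewrite -[f in LHS](poly_take_drop 1) hornerD hornerM hornerXn expr1 addrC.
  congr (_ + _); rewrite horner_poly big_ord_recr big_ord0 /= add0r.
  by rewrite expr0 mulr1 horner_coef0.
have KR : K = (Re K)%:C by rewrite RRe_real // ger0_real.
have rK0 : 0 <= Re K by rewrite -ler0c -KR.
pose h := Num.min 1 (- Re f.[0] / (2 * (Re K + 1))).
have h0 : 0 < h.
  rewrite lt_min ltr01 /=; apply: divr_gt0; first by rewrite oppr_gt0.
  by rewrite mulr_gt0 // ltr_wpDl.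
have h1 : h <= 1 by rewrite ge_min lexx.
have hK : h * (2 * (Re K + 1)) <= - Re f.[0].
  by rewrite -ler_pdivlMr ?mulr_gt0 ?ltr_wpDl // ge_min lexx orbT.
have := Hf h h0; rewrite fE.
have nh : `|h%:C| <= 1 by rewrite ger0_norm ?lecR ?ler0c // ltW.
have := gK _ nh; move: ((drop_poly 1 f).[_]) => [a b].
rewrite KR normc_def lecR /= => abK.
have aK : a <= Re K.
  apply: le_trans abK; apply: le_trans (ler_norm _) _; rewrite -sqrtr_sqr.
  by apply: ler_wsqrtr; rewrite lerDl sqr_ge0.
case: (f.[0]) f0 hK => u v /= f1 hK H.
have : a * h <= Re K * h by rewrite ler_pM2r.
nra.
Qed.

(* The inequalities are first proved for the positive definite directions [A + t],
   [B + t], [t > 0]; polynomiality in [t] then allows [t = 0]. *)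
Lemma mixbiv_perturb s Z A B : exists c : nat -> nat -> {poly C}, forall t i j,
  (c i j).[t] = ((mixbiv s Z (A + t *: 1%:M) (B + t *: 1%:M))`_i)`_j.
Proof.
pose Q := mixbiv (map_data polyC s) (map_mx polyC Z) (line_mx A 1%:M) (line_mx B 1%:M).
exists (fun i j => (Q`_i)`_j) => t i j.
have E (M : 'M[C]_d) : map_mx (horner_eval t) (line_mx M 1%:M) = M + t *: 1%:M.
  by apply/matrixP => k l; rewrite !mxE /= horner_evalE !hornerE.
rewrite -(E A) -(E B).
have -> : Z = map_mx (horner_eval t) (map_mx polyC Z).
  by apply/matrixP => k l; rewrite !mxE /= horner_evalE hornerC.
have {1}<- : map_data (horner_eval t) (map_data polyC s) = s.
  by rewrite map_data_comp map_data_id // => x; rewrite /= horner_evalE hornerC.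
by rewrite -mixbiv_map !coef_map.
Qed.

(** The matrix counterpart of lying above the largest root; it persists when a positive semidefinite
    matrix is added to [Z]. *)
Definition cone_above s Z := forall Y, psd Y -> 0 < mixdet s (Z + Y).

Lemma mixdet_adj s X : herm_data s -> mixdet s (adjmx X) = (mixdet s X)^*%C.
Proof.
move=> hs; rewrite [RHS]mixdet_map (map_data_herm hs) -(mixdet_tr s).
by congr mixdet; apply/matrixP => i j; rewrite !mxE.
Qed.

Lemma mixdet_im_neq0 s Z A B (h : R) (u : C) : mixture s -> adjmx Z = Z -> pd A ->
  psd B -> 0 < h -> 0 <= Im u -> (ev_inner (iC h) (mixbiv s Z A B)).[u] != 0.
Proof.
move=> [st _ _] hZ [_ pA] pB h0 u0; rewrite mixbiv_eval horner_mixpoly.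
apply: st; apply: im_pos_addZ => // x x0.
have [rA iA] := Re_gt0 (pA x x0).
by rewrite qformD qformZ raddfD /= (qform_herm _ hZ) Imc_mul /= mul0r !add0r mulr_gt0.
Qed.

Lemma psd_shift A (t : R) : 0 < t -> psd A -> pd (A + t%:C *: 1%:M).
Proof. by move=> t0 pA; apply: pdD => //; apply: pdZ t0 (pd1 _ _). Qed.

Lemma mixbiv_mixed_le0 s Z A B : mixture s -> adjmx Z = Z -> psd A -> psd B ->
  forall q, q = mixbiv s Z A B ->
  Re ((q`_1)`_1 * (q`_0)`_0 - (q`_1)`_0 * (q`_0)`_1) <= 0.
Proof.
move=> ms hZ pA pB q ->; have [c cE] := mixbiv_perturb s Z A B.
have c0 i j : ((mixbiv s Z A B)`_i)`_j = (c i j).[0] by rewrite cE !scale0r !addr0.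
rewrite !c0.
suff : 0 <= Re (c 1%N 0%N * c 0%N 1%N - c 1%N 1%N * c 0%N 0%N).[0].
  rewrite !hornerE; move: (_.[0]) (_.[0]) (_.[0]) (_.[0]) => [? ?] [? ?] [? ?] [? ?] /=; lra.
apply: Re_horner_ge0 => t t0; rewrite !hornerE !cE.
have pA' := psd_shift t0 pA; have pB' := psd_shift t0 pB.
have := biv_mixed_le0 (mixbiv_real (mixture_herm ms) hZ pA'.1 pB'.1) _.
move=> /(_ (fun h u h0 u0 => mixdet_im_neq0 ms hZ pA' (psd_of_pd pB') h0 u0)).
by move: (_`_1) (_`_0) (_`_0) (_`_1) => [? ?] [? ?] [? ?] [? ?] /=; lra.
Qed.

Lemma mixbiv_convex_ge0 s Z A B : mixture s -> adjmx Z = Z -> psd A -> psd B ->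
  cone_above s Z ->
  forall q, q = mixbiv s Z A B ->
  0 <= Re ((q`_0)`_0 * ((q`_2)`_1 * (q`_0)`_0 ^+ 2 - (q`_2)`_0 * (q`_0)`_1 * (q`_0)`_0
      - (q`_1)`_0 * (q`_1)`_1 * (q`_0)`_0 + (q`_1)`_0 ^+ 2 * (q`_0)`_1)).
Proof.
move=> ms hZ pA pB aZ q ->; have [c cE] := mixbiv_perturb s Z A B.
have c0 i j : ((mixbiv s Z A B)`_i)`_j = (c i j).[0] by rewrite cE !scale0r !addr0.
rewrite !c0.
suff : 0 <= Re (c 0%N 0%N * (c 2%N 1%N * c 0%N 0%N ^+ 2 - c 2%N 0%N * c 0%N 1%N * c 0%N 0%N
    - c 1%N 0%N * c 1%N 1%N * c 0%N 0%N + c 1%N 0%N ^+ 2 * c 0%N 1%N)).[0].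
  by rewrite !hornerE.
apply: Re_horner_ge0 => t t0; rewrite !hornerE !cE.
have pA' := psd_shift t0 pA; have pB' := psd_shift t0 pB.
set q' := mixbiv _ _ _ _.
have rq : real_biv q' := mixbiv_real (mixture_herm ms) hZ pA'.1 pB'.1.
have Hq h u (h0 : 0 < h) (u0 : 0 <= Im u) : (ev_inner (iC h) q').[u] != 0.
  exact: (mixdet_im_neq0 ms hZ pA' (psd_of_pd pB') h0 u0).
(* The perturbed [B + t] is positive definite, so this top coefficient is nonzero, as the
   perturbation of roots requires. *)
have [sq qd] : (size q' <= d.+1)%N /\ q'`_d = (\det (B + t%:C *: 1%:M))%:P.
  have [-> ->] := mixpoly_lead (map_data polyC s) (line_mx Z (A + t%:C *: 1%:M))
    (map_mx polyC (B + t%:C *: 1%:M)).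
  rewrite det_map_mx big_map /= -(rmorph_sum polyC) /=.
  by rewrite (mixture_mass ms) mul1r.
have := @biv_convex_ge0 _ q' d rq sq.
rewrite !qd !coefC /= det_pd // !expr2 !mulrA => /(_ isT (size_polyC_leq1 _) _ Hq); apply.
(* Stability excludes roots with positive imaginary part, conjugation those with negative one, and
   [cone_above] the nonnegative reals. *)
move=> z; rewrite mixbiv_eval scale0r addr0 /root horner_mixpoly => /eqP rz.
have up v : 0 < Im v -> mixdet s (Z + v *: (B + t%:C *: 1%:M)) != 0.
  move=> v0; apply: (mixture_stable ms) => x x0.
  have [rB iB] := Re_gt0 (pB'.2 x x0).
  by rewrite qformD qformZ raddfD /= (qform_herm _ hZ) Imc_mul iB mulr0 !add0r mulr_gt0.
have [z0|z0|z0] := ltgtP (Im z) 0.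
- have /up : 0 < Im z^*%C by case: (z) z0 => a b /=; lra.
  have -> : Z + z^*%C *: (B + t%:C *: 1%:M) = adjmx (Z + z *: (B + t%:C *: 1%:M)).
    by rewrite adjmxD adjmxZ hZ pB'.1.
  by rewrite (mixdet_adj _ (mixture_herm ms)) rz conjc0 eqxx.
- by move/eqP: (up z z0) => /(_ rz).
- split => //; rewrite ltNge; apply/negP => rz0.
  have := aZ _ (psdZ rz0 (psd_of_pd pB')).
  have <- : z = (Re z)%:C by rewrite [LHS]complexE z0 mulr0 addr0.
  by rewrite rz ltxx.
Qed.

Lemma coef_shift (S : comNzRingType) (p : {poly S}) (c : S) :
  [/\ (p \Po ('X + c%:P))`_0 = p.[c], (p \Po ('X + c%:P))`_1 = p^`().[c] &
      (p \Po ('X + c%:P))`_2 *+ 2 = p^`()^`().[c]].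
Proof.
have D (q : {poly S}) : (q \Po ('X + c%:P))^`() = q^`() \Po ('X + c%:P).
  by rewrite deriv_comp derivD derivX derivC addr0 mulr1.
have E (q : {poly S}) : (q \Po ('X + c%:P))`_0 = q.[c].
  by rewrite -horner_coef0 horner_comp !hornerE.
split=> //; first by rewrite -E -D coef_deriv.
by rewrite -E -!D !coef_deriv.
Qed.

(** [P] is the coefficient of [t ^ j], read as a real polynomial in [u]. For [mixbiv], slices 0 and
    1 carry the mixture and its derivative [D_A]. *)
Definition slice (q : {poly {poly C}}) j (P : {poly R}) :=
  forall i, (q`_i)`_j = (P`_i)%:C.

Lemma slice_ex q j : real_biv q -> exists P, slice q j P.
Proof.
move=> rq; exists (\poly_(i < size q) Re (q`_i)`_j) => i; rewrite coef_poly.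
case: ltnP => [_|/(nth_default 0) ->]; last by rewrite coef0.
rewrite RRe_real //; have := real_coef (rq i) j.
by case: (_`_j) => a b /= ->; apply/complex_realP; exists a.
Qed.

Lemma slice_horner q j P x : slice q j P -> (q.[x%:C%:P])`_j = (P.[x])%:C.
Proof.
move=> qP; rewrite (horner_coef_wide x (leq_maxr (size q) (size P))).
rewrite (horner_coef_wide _ (leq_maxl (size q) (size P))) coef_sum rmorph_sum /=.
by apply: eq_bigr => i _; rewrite -rmorphXn /= coefMC qP rmorphM /= rmorphXn.
Qed.

Lemma slice_deriv q j P : slice q j P -> slice q^`() j P^`().
Proof. by move=> qP i; rewrite !coef_deriv coefMn qP rmorphMn. Qed.

(* [N / Q] is the barrier function of direction [A] along the line [Z + x B]. *)
Lemma mix_ratio s Z A B : mixture s -> adjmx Z = Z -> psd A -> psd B ->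
  exists N Q : {poly R}, [/\
    (forall x, [/\ mixdet s (Z + x%:C *: B) = (Q.[x])%:C,
      (mixpoly s (Z + x%:C *: B) A)`_1 = (N.[x])%:C,
      (mixpoly s (Z + x%:C *: B) B)`_1 = (Q^`().[x])%:C &
      ((mixbiv s (Z + x%:C *: B) A B)`_1)`_1 = (N^`().[x])%:C]),
    (forall x, N^`().[x] * Q.[x] - N.[x] * Q^`().[x] <= 0),
    (cone_above s Z -> forall x, 0 <= x ->
       0 <= Q.[x] * (N^`()^`().[x] * Q.[x] ^+ 2 - Q^`()^`().[x] * N.[x] * Q.[x]
         - 2 * Q^`().[x] * N^`().[x] * Q.[x] + 2 * Q^`().[x] ^+ 2 * N.[x])),
    (size N <= d)%N & (size Q <= d.+1)%N /\ (Q`_d)%:C = \det B].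
Proof.
move=> ms hZ pA pB; set q := mixbiv s Z A B.
have rq : real_biv q := mixbiv_real (mixture_herm ms) hZ pA.1 pB.1.
have [Q qQ] := slice_ex 0 rq; have [N qN] := slice_ex 1 rq.
exists N, Q.
have hZx x : adjmx (Z + x%:C *: B) = Z + x%:C *: B.
  by rewrite adjmxD adjmxZR hZ pB.1.
have cE x j P : slice q j P ->
    [/\ ((mixbiv s (Z + x%:C *: B) A B)`_0)`_j = (P.[x])%:C,
        ((mixbiv s (Z + x%:C *: B) A B)`_1)`_j = (P^`().[x])%:C &
        ((mixbiv s (Z + x%:C *: B) A B)`_2)`_j *+ 2 = (P^`()^`().[x])%:C].
  move=> qP; rewrite mixbiv_shift; have [-> -> E] := coef_shift q x%:C%:P.
  rewrite -coefMn E; split; apply: slice_horner => //; first exact: slice_deriv.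
  by do 2 apply: slice_deriv.
have hB x : (mixpoly s (Z + x%:C *: B) B)`_1 = (Q^`().[x])%:C.
  have [_ <- _] := cE x 0%N Q qQ.
  have := mixbiv_eval s (Z + x%:C *: B) A B 0; rewrite scale0r addr0 => <-.
  by move: (mixbiv _ _ _ _) => q'; rewrite coef_ev_inner horner_coef0.
have mZ x : mixdet s (Z + x%:C *: B) = (Q.[x])%:C.
  have [<- _ _] := cE x 0%N Q qQ.
  by rewrite mixbiv_coef0 -horner_coef0 horner_mixpoly scale0r addr0.
have [sq qd] : (size q <= d.+1)%N /\ q`_d = (\det B)%:P.
  have [-> ->] := mixpoly_lead (map_data polyC s) (line_mx Z A) (map_mx polyC B).
  rewrite det_map_mx big_map /= -(rmorph_sum polyC) /=.
  by rewrite (mixture_mass ms) mul1r.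
split.
- move=> x; have [c01 c11 _] := cE x 1%N N qN.
  split; [exact: mZ | | exact: hB | exact: c11].
  by rewrite -c01 mixbiv_coef0.
- move=> x; have [c00 c10 c20] := cE x 0%N Q qQ; have [c01 c11 c21] := cE x 1%N N qN.
  have := mixbiv_mixed_le0 ms (hZx x) pA pB erefl; rewrite /= c00 c10 c01 c11.
  by rewrite -!rmorphM -rmorphB /= [N.[x] * _]mulrC.
- move=> aZ x x0; have [c00 c10 c20] := cE x 0%N Q qQ; have [c01 c11 c21] := cE x 1%N N qN.
  have aZx : cone_above s (Z + x%:C *: B).
    by move=> Y pY; have := aZ _ (psdD (psdZ x0 pB) pY); rewrite addrA.
  have := mixbiv_convex_ge0 ms (hZx x) pA pB aZx erefl; rewrite /= c00 c10 c01 c11.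
  (* Taylor coefficients of order two are half the second derivatives, whence the factors 2 in the
     convexity inequality. *)
  have half (z : C) (r : R) : z *+ 2 = r%:C -> z = (r / 2)%:C.
    move=> E; apply: (@mulIf _ 2); rewrite ?pnatr_eq0 // mulr_natr E.
    by rewrite -(rmorph_nat (real_complex R)) -rmorphM /= divfK ?pnatr_eq0.
  rewrite (half _ _ c21) (half _ _ c20).
  rewrite -!rmorphXn -!rmorphM -!rmorphB -!rmorphD -!rmorphM /= => H.
  by lra.
(* The coefficient of [u ^ d] is the constant [\det B], without a term in [t], so [N] has degree
   below [d]. *)
- apply/leq_sizeP => i di; apply: (@complexI R); rewrite -qN.
  move: di; rewrite leq_eqVlt => /orP[/eqP<-|di]; first by rewrite qd coefC.
  by rewrite [q`_i]nth_default ?coef0 //; apply: leq_trans di.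
- split; last by rewrite -qQ qd coefC.
  apply/leq_sizeP => i di; apply: (@complexI R); rewrite -qQ.
  by rewrite [q`_i]nth_default ?coef0 //; apply: leq_trans di.
Qed.
End BarrierRatio.

(** * Real polynomials on half-lines *)

Section PolynomialsAtInfinity.
Variable R : realType.
Implicit Types N Q : {poly R}.

Lemma poly_gt0_of_no_root Q a : 0 < lead_coef Q ->
  (forall x, a <= x -> ~~ root Q x) -> 0 < Q.[a].
Proof.
move=> lQ nr; rewrite ltNge; apply/negP => Qa.
have [n Hn] := poly_pinfty_gt_lc lQ.
have an : a <= Num.max a n by rewrite le_max lexx.
have Qn : 0 <= Q.[Num.max a n].
  by apply: ltW; apply: lt_le_trans lQ _; apply: Hn; rewrite le_max lexx orbT.
have [|x /andP[ax _]] := @polyrcf.poly_ivt _ Q a (Num.max a n) an.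
  by rewrite mulr_le0_ge0.
by apply/negP/nr.
Qed.

Lemma seq_max (s : seq R) x0 : x0 \in s -> exists2 m, m \in s & forall x, x \in s -> x <= m.
Proof.
elim: s x0 => // a s IH x0 _; case: s IH => [|b s] IH.
  by exists a => [|x]; rewrite inE // => /eqP ->.
have [|m ms Hm] := IH b; first by rewrite inE eqxx.
have [am|/ltW ma] := lerP a m.
  by exists m => [|x]; rewrite inE ?ms ?orbT // => /orP[/eqP->|/Hm].
exists a => [|x]; first by rewrite inE eqxx.
by rewrite [x \in _]inE => /orP[/eqP->|/Hm xm] //; apply: le_trans xm ma.
Qed.

Lemma largest_root Q a : 0 < lead_coef Q -> root Q a ->
  exists b, [/\ a <= b, root Q b & forall x, b < x -> 0 < Q.[x]].
Proof.
move=> lQ ra; have Q0 : Q != 0 by rewrite -lead_coef_eq0 gt_eqF.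
have inR x : (x \in rootsR Q) = root Q x by rewrite -(roots_on_rootsR Q0).
have ain : a \in rootsR Q by rewrite inR.
have [b] := seq_max ain; rewrite inR => rb Hb.
exists b; split; [exact: Hb | exact: rb |].
move=> x bx; apply: poly_gt0_of_no_root => // y xy; apply/negP => ry.
have := Hb y; rewrite inR => /(_ ry) yb.
by have := lt_le_trans bx (le_trans xy yb); rewrite ltxx.
Qed.

(* By the sign of the Wronskian, [N / Q] decreases to its limit 0 at infinity. *)
Lemma ratio_num_ge0 N Q x0 : 0 < lead_coef Q -> (size N < size Q)%N ->
  (forall x, x0 <= x -> 0 < Q.[x]) -> (forall x, x0 <= x -> (wronskian N Q).[x] <= 0) ->
  0 <= N.[x0].
Proof.
move=> lQ sN Q0 W0; rewrite leNgt; apply/negP => N0.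
(* Beyond [x0] the quotient stays at most [- c], so [N + c Q <= 0] there, although its leading
   coefficient is positive. *)
pose c := - N.[x0] / Q.[x0].
have c0 : 0 < c by rewrite divr_gt0 ?oppr_gt0 ?Q0.
have lc : 0 < lead_coef (N + c *: Q).
  by rewrite lead_coefDr ?size_scale ?gt_eqF // lead_coefZ mulr_gt0.
have [n Hn] := poly_pinfty_gt_lc lc.
pose x := Num.max x0 n; have x0x : x0 <= x by rewrite le_max lexx.
have := lt_le_trans lc (Hn x _); rewrite le_max lexx orbT => /(_ isT).
rewrite hornerD hornerZ.
have : N.[x] / Q.[x] <= N.[x0] / Q.[x0].
  by apply: ratio_noninc => // y /andP[? _]; [apply: Q0|apply: W0].
have -> : N.[x0] / Q.[x0] = - c by rewrite /c mulNr opprK.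
by rewrite ler_pdivrMr ?Q0 // mulNr; lra.
Qed.

Lemma horner_ge0_right N b : (forall x, b < x -> 0 <= N.[x]) -> 0 <= N.[b].
Proof.
move=> H; rewrite leNgt; apply/negP => Nb.
have Nb' : 0 < - N.[b] by rewrite oppr_gt0.
have [e e0 He] := poly_cont b N Nb'.
have e2 : 0 < e / 2 by rewrite divr_gt0.
have := He (b + e / 2); rewrite addrAC subrr add0r gtr0_norm //.
have := H (b + e / 2); rewrite ltrDl => /(_ e2) N0 /(_ _).
have -> : e / 2 < e by lra.
by move=> /(_ isT); rewrite ltr_norml => /andP[_]; lra.
Qed.
End PolynomialsAtInfinity.

Section Barrier.
Variables (R : realType) (d : nat).
Local Notation C := R[i].
Local Notation Re := complex.Re.
Local Notation "x %:C" := (real_complex R x).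
Implicit Types (X Y Z A B M : 'M[C]_d) (s : seq (C * 'M[C]_d)).

(** The derivative of [log g] at [Z] in direction [A], with [g = mixdet s]; both values are real for
    a mixture and Hermitian arguments. *)
Definition barrier s Z A : R := Re (mixpoly s Z A)`_1 / Re (mixdet s Z).

Definition prob_list (L : seq (R * 'cV[C]_d)) :=
  (forall pw, pw \in L -> 0 <= pw.1) /\ \sum_(pw <- L) pw.1 = 1.

Lemma barrierE s Z A (n q : R) : mixdet s Z = q%:C -> (mixpoly s Z A)`_1 = n%:C ->
  barrier s Z A = n / q.
Proof. by rewrite /barrier => -> ->. Qed.

Lemma addZ0C Z Y : Z + 0%:C *: Y = Z.
Proof. by rewrite (_ : 0%:C = 0) // scale0r addr0. Qed.

Lemma addZ1C Z Y : Z + 1%:C *: Y = Z + Y.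
Proof. by rewrite (_ : 1%:C = 1) // scale1r. Qed.

(** Along [Z + x Y] the barrier is [N / Q], with [Q] positive on the cone and the Wronskian
    nonpositive by the mixed inequality. *)
Lemma barrier_noninc s Z Y A : mixture s -> adjmx Z = Z -> cone_above s Z ->
  psd A -> psd Y -> barrier s (Z + Y) A <= barrier s Z A.
Proof.
move=> ms hZ aZ pA pY; have [N [Q [E W _ _ _]]] := mix_ratio ms hZ pA pY.
have [E0 E1 _ _] := E 0; have [E0' E1' _ _] := E 1.
rewrite addZ0C in E0 E1; rewrite addZ1C in E0' E1'.
rewrite (barrierE E0 E1) (barrierE E0' E1').
apply: ratio_noninc => // x /andP[x0 _].
  have [Ex _ _ _] := E x; rewrite -ltcR -Ex; apply: aZ.
  exact: psdZ.
by rewrite /wronskian !hornerE.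
Qed.

(** The step multiplies [g] by 1 minus the barrier, and a barrier below 1 at [Z] stays so at [Z + Y]
    by monotonicity. *)
Lemma mix_step_cone_above s Z L : mixture s -> adjmx Z = Z -> cone_above s Z ->
  prob_list L -> barrier s Z (outer_avg L) < 1 -> cone_above (mix_step L s) Z.
Proof.
move=> ms hZ aZ [L0 L1] b1 Y pY; rewrite mixdet_step_deriv //.
have pA := psd_outer_avg L0.
have := barrier_noninc ms hZ aZ pA pY.
have [N [Q [E _ _ _ _]]] := mix_ratio ms hZ pA pY.
have [E0 E1 _ _] := E 1; rewrite addZ1C in E0 E1.
have Q0 : 0 < Q.[1] by rewrite -ltcR -E0 aZ.
rewrite (barrierE E0 E1) => /le_lt_trans/(_ b1).
rewrite E0 E1.
by rewrite ltr_pdivrMr // mul1r -rmorphB /= ltcR subr_gt0.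
Qed.

(** Let [f] and [b] be the barriers in directions [A] and [B] along [Z + x B]. After the step the
    barrier at [x = t] is [f(t) - f'(t) / (1 - b(t))]. Since [f'(t) <= 0] and [1 - b(t) >= 1 / t],
    it is at most [f(t) - t f'(t)], which convexity bounds by [f(0)]. *)
Lemma barrier_step s Z A L (t : R) : mixture s -> adjmx Z = Z -> cone_above s Z ->
  prob_list L -> psd A -> 0 < t -> barrier s Z (outer_avg L) <= 1 - t^-1 ->
  barrier (mix_step L s) (Z + t%:C *: outer_avg L) A <= barrier s Z A.
Proof.
move=> ms hZ aZ [L0 L1] pA t0 bL; set B := outer_avg L in bL *.
have pB : psd B := psd_outer_avg L0.
have [N [Q [E W W2 _ _]]] := mix_ratio ms hZ pA pB.
have Q0 x : 0 <= x -> 0 < Q.[x].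
  by move=> x0; have [Ex _ _ _] := E x; rewrite -ltcR -Ex; apply: aZ; apply: psdZ.
have [D0 N0 _ _] := E 0; have [Dt Nt Q't N't] := E t.
have tP := ltW t0.
have := barrier_noninc ms hZ aZ pB (psdZ tP pB).
rewrite (barrierE Dt Q't) => /le_trans/(_ bL) Qt.
have tan : N.[t] / Q.[t] - N.[0] / Q.[0] <= (wronskian N Q).[t] / Q.[t] ^+ 2 * (t - 0).
  apply: ratio_tangent => // x /andP[x0 _]; first exact: Q0.
  by rewrite horner_wronskian2; apply: W2.
rewrite addZ0C in D0 N0; rewrite (barrierE D0 N0).
rewrite (@barrierE _ _ _ (N.[t] - N^`().[t]) (Q.[t] - Q^`().[t])); last first.
- by rewrite mixpoly_step // coefB mixbiv_coef0 -/B Nt N't rmorphB.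
- by rewrite mixdet_step_deriv // -/B Dt Q't rmorphB.
have := W t; move: tan; rewrite subr0 /wronskian !hornerE.
have := Q0 t tP; have := Q0 0 (lexx _); move: Qt.
move: (Q.[0]) (N.[0]) (Q.[t]) (N.[t]) (Q^`().[t]) (N^`().[t]) => q0 n0 q n q' n'.
move=> Hq' q0P qP tan w.
have qq' : q <= (q - q') * t.
  move: Hq'; rewrite ler_pdivrMr // mulrBl mul1r => Hq'.
  have : t^-1 * q <= q - q' by lra.
  by rewrite mulrC ler_pdivrMr.
have qq'0 : 0 < q - q' by rewrite -(pmulr_lgt0 _ t0); apply: lt_le_trans qP qq'.
have -> : (n - n') / (q - q') = n / q + (- (n' * q - n * q')) * ((q - q')^-1 / q).
  by field; rewrite !gt_eqF.
apply: (@le_trans _ _ (n / q + (- (n' * q - n * q')) * (t / q ^+ 2))).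
  rewrite lerD2l ler_wpM2l ?oppr_ge0 // ler_pdivlMr ?exprn_gt0 //.
  rewrite expr2 mulrA divfK ?gt_eqF // mulrC ler_pdivrMr // mulrC.
  by [].
lra.
Qed.
End Barrier.

(** * Interlacing selection *)

Section Selection.
Variables (R : realType) (d : nat).
Local Notation C := R[i].
Local Notation Re := complex.Re.
Local Notation "x %:C" := (real_complex R x).
Implicit Types (X Y Z A B M : 'M[C]_d) (s : seq (C * 'M[C]_d)).

Lemma mixdet_sub_outer s X w :
  mixdet s (X - outer w) = mixdet s X - (mixpoly s X (outer w))`_1.
Proof.
have E : outer_avg [:: (1 : R, w)] = outer w.
  by rewrite /outer_avg big_seq1 /= (_ : 1%:C = 1) // scale1r.
have := coef1_mixpoly [:: (1 : R, w)] s X.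
by rewrite E big_seq1 /= (_ : 1%:C = 1) // mul1r => ->; rewrite subKr.
Qed.

(** In the identity direction [Q] has leading coefficient [\det 1 = 1], so its sign at infinity is
    known and its degree exceeds that of [N]. *)
Lemma monic_along_id s Z A : mixture s -> adjmx Z = Z -> psd A ->
  exists N Q : {poly R}, [/\ 0 < lead_coef Q, (size N < size Q)%N,
    (forall x, (wronskian N Q).[x] <= 0) &
    forall x, mixdet s (Z + x%:C *: 1%:M) = (Q.[x])%:C /\
              (mixpoly s (Z + x%:C *: 1%:M) A)`_1 = (N.[x])%:C].
Proof.
move=> ms hZ pA; have [N [Q [E W _ sN [sQ Qd]]]] := mix_ratio ms hZ pA (psd1 R d).
have {}Qd : Q`_d = 1 by apply: (@complexI R); rewrite Qd det1.
have sQd : size Q = d.+1.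
  apply/eqP; rewrite eqn_leq sQ ltnNge; apply/negP => /leq_sizeP /(_ d (leqnn d)).
  by rewrite Qd => /eqP; rewrite oner_eq0.
exists N, Q; split => [||x|x].
- by rewrite /lead_coef sQd /= Qd.
- by rewrite sQd ltnS.
- by rewrite /wronskian !hornerE.
- by have [E0 E1 _ _] := E x; split; [exact: E0 | exact: E1].
Qed.

(* Beyond the largest root [b] of [Q] the numerator [N] is nonnegative, hence also
   at [b]; so [Q - N > 0] on the half-line leaves no root of [Q] there, and each
   [1 - N' / Q] is nondecreasing: it is enough that one of them be positive at 0. *)
Lemma select_step s Z L : mixture s -> adjmx Z = Z -> prob_list L ->
  (forall x, 0 <= x -> 0 < mixdet (mix_step L s) (Z + x%:C *: 1%:M)) ->
  exists2 pw, pw \in L & 0 < pw.1 /\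
    forall x, 0 <= x -> 0 < mixdet s (Z - outer pw.2 + x%:C *: 1%:M).
Proof.
move=> ms hZ [L0 L1] Hp.
have pB := psd_outer_avg L0.
have [N [Q [lQ sN W E]]] := monic_along_id ms hZ pB.
have QN x : 0 <= x -> N.[x] < Q.[x].
  move=> x0; have := Hp x x0; rewrite mixdet_step_deriv //.
  by have [-> ->] := E x; rewrite -rmorphB ltcR subr_gt0.
have Q0 x : 0 <= x -> 0 < Q.[x].
  move=> x0; apply: poly_gt0_of_no_root => // y xy; apply/negP => ry.
  have [b [yb rb Hb]] := largest_root lQ ry.
  have := QN b (le_trans x0 (le_trans xy yb)); rewrite (rootP rb); apply/negP.
  rewrite -leNgt; apply: horner_ge0_right => z bz; apply: ratio_num_ge0 lQ sN _ _ => // u zu.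
  exact/Hb/(lt_le_trans bz).
have : 0 < mixdet (mix_step L s) Z by have := Hp 0 (lexx _); rewrite addZ0C.
rewrite mixdet_stepE => Spos.
have [pw pwL Hpw] : exists2 pw, pw \in L & 0 < pw.1 * Re (mixdet s (Z - outer pw.2)).
  apply/hasP; apply: contraTT Spos => /hasPn H; apply/negP => /Re_gt0[+ _].
  apply/negP; rewrite -leNgt.
  have -> : forall r : seq (R * 'cV[C]_d),
      Re (\sum_(pw <- r) pw.1%:C * mixdet s (Z - outer pw.2)) =
      \sum_(pw <- r) pw.1 * Re (mixdet s (Z - outer pw.2)).
    elim=> [|pw r IH]; first by rewrite !big_nil.
    by rewrite !big_cons -IH raddfD /= Rec_mul /= mul0r subr0.
  by rewrite big_seq sumr_le0 // => pw /H; rewrite -leNgt.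
have p0 := L0 pw pwL.
have p1 : 0 < pw.1.
  by rewrite lt_neqAle p0 andbT; apply: contraTneq Hpw => <-; rewrite mul0r ltxx.
exists pw; [exact: pwL | split; first exact: p1].
move=> x x0; move: Hpw; rewrite pmulr_rgt0 // => Hpw.
(* The numerator for the chosen vector on the same half-line: [Q'] takes the values of [Q], and
   [Q - N'] is the mixture with that vector fixed. *)
have [N' [Q' [_ _ W' E']]] := monic_along_id ms hZ (psd_outer pw.2).
have QE y : Q'.[y] = Q.[y].
  by apply: (@complexI R); rewrite -(E y).1 -(E' y).1.
have ZE y : mixdet s (Z - outer pw.2 + y%:C *: 1%:M) = (Q.[y] - N'.[y])%:C.
  by rewrite addrAC mixdet_sub_outer (E' y).1 (E' y).2 QE rmorphB.
have := ZE 0; rewrite addZ0C => Z0; move: Hpw; rewrite Z0 /= => N'0.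
rewrite ZE ltcR subr_gt0.
have := @ratio_noninc _ N' Q' 0 x x0 _ (fun y _ => W' y); rewrite !QE.
have Q'0 y : 0 <= y <= x -> 0 < Q'.[y] by move=> /andP[y0 _]; rewrite QE Q0.
move=> /(_ Q'0) H; rewrite -[ltRHS]mul1r -ltr_pdivrMr ?Q0 //; apply: le_lt_trans H _.
by rewrite ltr_pdivrMr ?Q0 // mul1r -subr_gt0.
Qed.

End Selection.

(** * Iteration over finitely many discrete laws *)

Section DiscreteTheorem.
Variables (R : realType) (d : nat) (I : eqType) (L : I -> seq (R * 'cV[R[i]]_d)).
Local Notation C := R[i].
Local Notation Re := complex.Re.
Local Notation "x %:C" := (real_complex R x).
Implicit Types (X Y Z A B M : 'M[C]_d) (r : seq I).

Definition det_data : seq (C * 'M[C]_d) := [:: (1, 0)].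

Definition mix_steps r := foldr (fun i s => mix_step (L i) s) det_data r.

Lemma mixdet_det X : mixdet det_data X = \det X.
Proof. by rewrite /mixdet big_seq1 /= mul1r subr0. Qed.

Lemma mixture_steps r : {in r, forall i, prob_list (L i)} -> mixture (mix_steps r).
Proof.
elim: r => [|i r IH] pr /=; first exact: mixture_det.
have [p0 p1] : prob_list (L i) by apply: pr; rewrite inE eqxx.
apply: mixture_step => //; apply: IH => j jr.
by apply: pr; rewrite inE jr orbT.
Qed.

(** The monic polynomial [\det (X + x I)] has no root [x >= 0], since [X + x I] is positive definite
    there. *)
Lemma det_pd_gt0 X : pd X -> 0 < \det X.
Proof.
move=> pX; have [N [Q [lQ _ _ E]]] := monic_along_id (mixture_det R d) pX.1 (psd0 R d).
have QE x : (Q.[x])%:C = \det (X + x%:C *: 1%:M).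
  by rewrite -(E x).1 -/det_data mixdet_det.
have := QE 0; rewrite addZ0C => <-; rewrite ltcR.
apply: poly_gt0_of_no_root => // x x0; apply/negP => /rootP rx.
have := QE x; rewrite rx => /esym/eqP; apply/negP/det_pd.
by rewrite addrC; apply: pdD pX; apply: psdZ (psd1 R d).
Qed.

Lemma det_cone_above (t : R) : 0 < t -> cone_above det_data (t%:C *: 1%:M).
Proof.
move=> t0 Y pY; rewrite mixdet_det; apply: det_pd_gt0.
by rewrite addrC; apply: pdD pY _; apply: pdZ t0 (pd1 R d).
Qed.

Definition norm2 (w : 'cV[C]_d) : R := Re (qform 1%:M w).

Lemma norm2E w : qform 1%:M w = (norm2 w)%:C.
Proof. by rewrite /norm2 RRe_real // ger0_real // (psd1 R d).2. Qed.

(** By Jacobi's formula at a scalar matrix the barrier is the trace of [outer_avg K] over [t], and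
    this trace is the mean squared norm. *)
Lemma barrier_det (t : R) (K : seq (R * 'cV[C]_d)) : 0 < t ->
  barrier det_data (t%:C *: 1%:M) (outer_avg K) = (\sum_(pw <- K) pw.1 * norm2 pw.2) / t.
Proof.
move=> t0.
have D : mixdet det_data (t%:C *: 1%:M) = (t ^+ d)%:C.
  by rewrite mixdet_det detZ det1 mulr1 rmorphXn.
have N : (mixpoly det_data (t%:C *: 1%:M) (outer_avg K))`_1 =
    (t ^+ d.-1 * \sum_(pw <- K) pw.1 * norm2 pw.2)%:C.
  rewrite /mixpoly /mixdet big_seq1 /= mul1r map_mx0 subr0 coef1_det_line.
  rewrite rmorphM rmorph_sum mulr_sumr /=; apply: eq_bigr => pw _.
  rewrite adjZ adj1 qformZ norm2E mulrCA rmorphM rmorphXn.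
  by [].
rewrite (barrierE D N).
(* For [d = 0], [d.-1] is 0 and the powers of [t] do not combine to [1 / t]; there all squared norms
   vanish. *)
have [d0|dP] := posnP d.
  rewrite big1 ?mulr0 ?mul0r // => pw _.
  by rewrite /norm2 /qform mxE big1 ?mulr0 // => i; have := ltn_ord i; rewrite {2}d0.
rewrite -[in t ^+ d](prednK dP) exprS; move: (\sum_(pw <- K) _) => S.
by field; rewrite expf_neq0 gt_eqF.
Qed.

(** Each step moves the point by [k] times the next average without raising any barrier. As this
    holds for every direction [A], the initial bound [1 - 1 / k] is still available for the next
    vector. *)
Lemma barrier_steps (t k : R) r : 0 < t -> 0 < k ->
  {in r, forall i, prob_list (L i)} ->
  {in r, forall i, \sum_(pw <- L i) pw.1 * norm2 pw.2 / t <= 1 - k^-1} ->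
  let Z := t%:C *: 1%:M + k%:C *: \sum_(i <- r) outer_avg (L i) in
  cone_above (mix_steps r) Z /\
  forall A, psd A -> barrier (mix_steps r) Z A <= barrier det_data (t%:C *: 1%:M) A.
Proof.
move=> t0 k0; elim: r => [|i r IH] pr br /=.
  by rewrite big_nil scaler0 addr0; split => //; apply: det_cone_above.
have prr : {in r, forall i, prob_list (L i)}.
  by move=> j jr; apply: pr; rewrite inE jr orbT.
have [|aZ bZ] := IH prr; first by move=> j jr; apply: br; rewrite inE jr orbT.
have pi : prob_list (L i) by apply: pr; rewrite inE eqxx.
have pA := psd_outer_avg pi.1.
have ms := mixture_steps prr.
set Z := t%:C *: 1%:M + k%:C *: \sum_(j <- r) outer_avg (L j) in aZ bZ.
have hZ : adjmx Z = Z.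
  suff pS : psd (\sum_(j <- r) outer_avg (L j)).
    by rewrite /Z adjmxD !adjmxZR adjmx1 pS.1.
  rewrite big_seq; elim/big_ind: _ => [|X Y pX pY|j jr]; first exact: psd0.
    exact: psdD.
  exact: psd_outer_avg (prr j jr).1.
have bi : barrier (mix_steps r) Z (outer_avg (L i)) <= 1 - k^-1.
  apply: le_trans (bZ _ pA) _; rewrite barrier_det // mulr_suml; apply: br.
  by rewrite inE eqxx.
have bi1 : barrier (mix_steps r) Z (outer_avg (L i)) < 1.
  by apply: le_lt_trans bi _; rewrite ltrBlDr ltrDl invr_gt0.
have -> : t%:C *: 1%:M + k%:C *: \sum_(j <- i :: r) outer_avg (L j) =
    Z + k%:C *: outer_avg (L i).
  by rewrite big_cons scalerDr /Z -addrA [X in _ + X]addrC.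
split=> [Y pY|A pA'].
  rewrite -addrA; apply: (mix_step_cone_above ms hZ aZ pi bi1).
  by apply: psdD pY; apply: psdZ pA; apply: ltW.
by apply: le_trans (bZ A pA'); apply: barrier_step.
Qed.

(** The head of [r] is the outermost step of [foldr], so it is fixed first; the induction then
    continues from [Z - outer pw.2]. *)
Lemma select_steps r Z : uniq r -> {in r, forall i, prob_list (L i)} -> adjmx Z = Z ->
  (forall x, 0 <= x -> 0 < mixdet (mix_steps r) (Z + x%:C *: 1%:M)) ->
  exists f : I -> R * 'cV[C]_d,
    {in r, forall i, f i \in L i /\ 0 < (f i).1} /\
    forall x, 0 <= x -> 0 < \det (Z - \sum_(i <- r) outer (f i).2 + x%:C *: 1%:M).
Proof.
elim: r Z => [|i r IH] Z ur pr hZ Hp.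
  exists (fun=> (0, 0)); split => // x x0; have := Hp x x0.
  by rewrite mixdet_det big_nil subr0.
have prr : {in r, forall i, prob_list (L i)}.
  by move=> j jr; apply: pr; rewrite inE jr orbT.
have pi : prob_list (L i) by apply: pr; rewrite inE eqxx.
have [pw pwL [p0 Hpw]] := select_step (mixture_steps prr) hZ pi Hp.
move: ur => /= /andP[ir ur].
have hZ' : adjmx (Z - outer pw.2) = Z - outer pw.2.
  by rewrite adjmxD adjmxN hZ adjmx_outer.
have [f [Hf Hd]] := IH _ ur prr hZ' Hpw.
(* By uniqueness [i] is not in [r], so the override leaves the other choices intact. *)
exists (fun j => if j == i then pw else f j); split.
  move=> j; rewrite inE => /orP[/eqP->|jr]; first by rewrite eqxx.
  by case: eqP jr => [-> /(negP ir)//|_ /Hf].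
move=> x x0; rewrite big_cons eqxx.
rewrite (eq_big_seq (fun j => outer (f j).2)); last first.
  by move=> j jr; case: eqP jr => // -> /(negP ir).
by rewrite opprD addrA; apply: Hd.
Qed.

(* Starting from [t I], [t = sqrt eps + eps], every barrier is at most
   [eps / t = 1 - 1 / k] with [k = 1 + sqrt eps]; the final point is
   [(t + k) I = (1 + sqrt eps) ^ 2 I]. *)
Theorem discrete_theorem r (eps : R) : 0 < eps -> uniq r ->
  {in r, forall i, prob_list (L i)} ->
  \sum_(i <- r) outer_avg (L i) = 1%:M ->
  {in r, forall i, \sum_(pw <- L i) pw.1 * norm2 pw.2 <= eps} ->
  exists f : I -> R * 'cV[C]_d,
    {in r, forall i, f i \in L i /\ 0 < (f i).1} /\
    forall x, 0 <= x -> 0 < \det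
      (((1 + Num.sqrt eps) ^+ 2)%:C *: 1%:M - \sum_(i <- r) outer (f i).2 + x%:C *: 1%:M).
Proof.
move=> e0 ur pr S1 Le.
have q0 : 0 < Num.sqrt eps by rewrite sqrtr_gt0.
have qq : Num.sqrt eps ^+ 2 = eps by rewrite sqr_sqrtr // ltW.
pose q := Num.sqrt eps; pose t := q + q ^+ 2; pose k := 1 + q.
have t0 : 0 < t by rewrite addr_gt0 // exprn_gt0.
have k0 : 0 < k by rewrite addr_gt0.
have br : {in r, forall i, \sum_(pw <- L i) pw.1 * norm2 pw.2 / t <= 1 - k^-1}.
  move=> i /Le H; rewrite -mulr_suml ler_pdivrMr //; apply: le_trans H _.
  rewrite -qq -/q /t /k le_eqVlt; apply/orP; left; apply/eqP; field.
  by rewrite gt_eqF.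
have [aZ _] := barrier_steps t0 k0 pr br.
apply: select_steps => // [|x x0]; first by rewrite adjmxZR adjmx1.
rewrite (_ : (_ ^+ 2)%:C *: 1%:M = t%:C *: 1%:M + k%:C *: \sum_(i <- r) outer_avg (L i)).
  by apply: aZ; apply: psdZ (psd1 R d).
rewrite S1 -scalerDl -rmorphD; congr (_%:C *: _).
by rewrite /t /k -/q; ring.
Qed.
End DiscreteTheorem.

(** * From determinants to probabilities *)

Section OperatorNorm.
Variables (R : realType) (d : nat).
Local Notation C := R[i].
Local Notation Re := complex.Re.
Local Notation "x %:C" := (real_complex R x).
Implicit Types (M P : 'M[C]_d) (w x : 'cV[C]_d).

Lemma norm2_sum w : norm2 w = \sum_i Normc.normc (w i 0) ^+ 2.
Proof.
rewrite /norm2 /qform mulmx1 mxE raddf_sum /=; apply: eq_bigr => i _.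
rewrite !mxE /=; case: (w i 0) => a b /=.
by rewrite sqr_sqrtr ?addr_ge0 ?sqr_ge0 //; ring.
Qed.

Lemma enorm_sqr w : enorm w ^+ 2 = norm2 w.
Proof.
by rewrite /enorm sqr_sqrtr ?norm2_sum // sumr_ge0 // => i _; apply: sqr_ge0.
Qed.

Lemma norm2_unitary P w : adjmx P *m P = 1%:M -> norm2 (P *m w) = norm2 w.
Proof.
move=> PP; rewrite /norm2 /qform !mulmx1 adjmxM mulmxA -(mulmxA _ _ P) PP.
by rewrite mulmx1.
Qed.

Lemma psd_spectral M : psd M -> exists (P : 'M[C]_d) (l : 'I_d -> R), [/\
  adjmx P *m P = 1%:M, P *m adjmx P = 1%:M, forall k, 0 <= l k &
  M = adjmx P *m diag_mx (\row_k (l k)%:C) *m P].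
Proof.
move=> [hM pM]; have nM : M \is normalmx.
  by apply/normalmxP; rewrite -[(M ^t* )%sesqui]/(adjmx M) hM.
have := nM; move=> /orthomx_spectralP E.
have uP := spectral_unitarymx M; rewrite (invmx_unitary uP) in E.
move: uP E; move: (spectralmx M) (spectral_diag M) => P sp uP E.
have PP : P *m adjmx P = 1%:M by apply/unitarymxP.
have PP' : adjmx P *m P = 1%:M by apply: mulmx1C.
rewrite -/(adjmx P) in E.
have spE k : 0 <= sp 0 k.
  (* The form of [M] at the eigenvector [adjmx P *m delta_mx k 0] is the eigenvalue [sp 0 k]. *)
  have := pM (adjmx P *m delta_mx k 0).
  rewrite {1}E /qform adjmxM adjmxK !mulmxA -(mulmxA _ P (adjmx P)) PP mulmx1.
  rewrite -!mulmxA (mulmxA P (adjmx P)) PP mul1mx mulmxA mul_mx_diag.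
  rewrite mxE (bigD1 k) //= big1 ?addr0 => [|i ik]; last first.
    by rewrite [delta_mx k 0 i 0]mxE (negbTE ik) mulr0.
  rewrite !mxE !eqxx mulr1 /= conjC1 mul1r.
  by [].
exists P, (fun k => Re (sp 0 k)); split; [exact: PP' | exact: PP | move=> k |].
  by have [] := Re_ge0 (spE k).
rewrite [LHS]E; congr (_ *m diag_mx _ *m _).
by apply/rowP => k; rewrite !mxE RRe_real // ger0_real.
Qed.

(** Nonvanishing of these determinants excludes eigenvalues [>= t]; unitary invariance of the norm
    reduces the bound to a diagonal matrix. *)
Lemma opnorm_le M (t : R) : psd M -> 0 <= t ->
  (forall x : R, 0 <= x -> 0 < \det (t%:C *: 1%:M - M + x%:C *: 1%:M)) -> opnorm M <= t.
Proof.
move=> pM t0 Ht; have [P [l [PP PP' l0 E]]] := psd_spectral pM.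
have lt k : l k < t.
  rewrite ltNge; apply/negP => tl.
  (* This shift turns the matrix into [l k I - M], which kills the eigenvector
     [adjmx P *m delta_mx k 0]. *)
  have := Ht (l k - t); rewrite subr_ge0 => /(_ tl) /gt_eqF/negbT.
  have -> : t%:C *: 1%:M - M + (l k - t)%:C *: 1%:M = (l k)%:C *: 1%:M - M.
    by rewrite addrAC -scalerDl -rmorphD [t + _]addrC subrK.
  rewrite -unitfE -unitmxE => uM.
  have Mv : ((l k)%:C *: 1%:M - M) *m (adjmx P *m delta_mx k (0 : 'I_1)) = 0.
    rewrite mulmxBl -scalemxAl mul1mx {1}E -!mulmxA (mulmxA P) PP' mul1mx.
    rewrite scalemxAr -mulmxBr [X in _ *m X](_ : _ = 0) ?mulmx0 //.
    apply/matrixP => i j; rewrite mul_diag_mx !mxE (ord1 j).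
    by case: eqP => [->|_]; rewrite ?mulr0 ?subr0 // subrr.
  have : delta_mx k (0 : 'I_1) = 0 :> 'cV[C]_d.
    rewrite -[LHS]mul1mx -PP' -mulmxA -[X in P *m X](mulKmx uM) Mv.
    by rewrite !mulmx0.
  by move=> /matrixP/(_ k 0); rewrite !mxE !eqxx => /eqP; rewrite oner_eq0.
rewrite /opnorm; set S := (X in sup X).
(* For [d = 0] there is no unit vector, and the supremum of the empty set is 0. *)
have [->|/set0P S0] := eqVneq S set0; first by rewrite sup0.
apply: ge_sup => // _ [u u1 <-]; rewrite /= in u1.
rewrite -(@ler_pXn2r _ 2) ?nnegrE ?sqrtr_ge0 // enorm_sqr E -!mulmxA.
rewrite norm2_unitary ?adjmxK // norm2_sum.
apply: (@le_trans _ _ (\sum_i t ^+ 2 * Normc.normc ((P *m u) i 0) ^+ 2)).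
  apply: ler_sum => i _; rewrite mul_diag_mx mxE [X in X * _]mxE Normc.normcM exprMn.
  rewrite ler_wpM2r ?sqr_ge0 //= expr0n addr0 sqr_sqrtr ?sqr_ge0 //.
  by rewrite ler_pXn2r ?nnegrE // ltW.
by rewrite -mulr_sumr -norm2_sum norm2_unitary // -enorm_sqr u1 expr1n mulr1.
Qed.
End OperatorNorm.

(** * Atoms and joint events of finitely supported vectors *)

Section FiniteSupport.
Variables (R : realType) (d : nat).

Lemma Cvec_hausdorff : hausdorff_space ('cV[R[i]^o]_d).
Proof. exact: norm_hausdorff. Qed.

Lemma measurable_Cvec1 (x : Cvec R d) : measurable [set x].
Proof.
rewrite -[X in measurable X]setCK; apply: measurableC.
apply: sub_sigma_algebra; apply: closed_openC.
apply: accessible_closed_set1; apply: hausdorff_accessible.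
exact: Cvec_hausdorff.
Qed.

Variables (dT : measure_display) (T : measurableType dT) (P : probability T R).
Variable X : {RV P >-> Cvec R d}.

Lemma measurable_fiber x : measurable (X @^-1` [set x]).
Proof.
rewrite -[X in measurable X]setTI; apply: measurable_funPT => //.
exact: measurable_Cvec1.
Qed.

Lemma finite_support_seq : finitely_supported X ->
  exists2 s : seq (Cvec R d), uniq s & forall w, X w \in s.
Proof.
move=> /finite_seqP[s sE]; exists (undup s); first exact: undup_uniq.
move=> w; rewrite mem_undup; have : range X (X w) by exists w.
by rewrite sE.
Qed.

Definition atom (x : Cvec R d) : R := fine (P (X @^-1` [set x])).

Lemma atomE x : (atom x)%:E = P (X @^-1` [set x]).
Proof. by rewrite /atom fineK // fin_num_measure //; exact: measurable_fiber. Qed.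

Lemma atom_ge0 x : 0 <= atom x.
Proof. by rewrite fine_ge0. Qed.

Lemma expectation_finite_support (s : seq (Cvec R d)) (f : Cvec R d -> R) :
  uniq s -> (forall w, X w \in s) ->
  ('E_P[fun w => f (X w)] = (\sum_(x <- s) f x * atom x)%R%:E)%E.
Proof.
move=> us Xs.
(* A combination of indicators of the fibers, integrated term by term. *)
have -> : (fun w => f (X w)) = (fun w => \sum_(x <- s) f x * \1_(X @^-1` [set x]) w).
  apply/funext => w; rewrite (bigD1_seq (X w)) //= indicE mem_set //= mulr1.
  rewrite big1 ?addr0 // => x xX; rewrite indicE memNset ?mulr0 //= => E.
  by rewrite E eqxx in xX.
rewrite unlock; under eq_integral do rewrite -sumEFin.
rewrite integral_sum //; last first.
  move=> x; under eq_fun do rewrite EFinM.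
  by apply: integrableZl => //; apply: integrable_indic => //; apply: measurable_fiber.
rewrite -sumEFin; apply: eq_bigr => x _.
under eq_integral do rewrite EFinM.
rewrite integralZl //; last by apply: integrable_indic => //; apply: measurable_fiber.
by rewrite integral_indic ?setIT //; [rewrite EFinM atomE | apply: measurable_fiber].
Qed.
End FiniteSupport.

Section Events.
Variables (R : realType) (d : nat).
Variables (dT : measure_display) (T : measurableType dT) (P : probability T R).

(** [s] only has to contain the values of [X], so weights may vanish; the selection returns entries
    of positive weight. *)
Definition atom_list (X : {RV P >-> Cvec R d}) (s : seq (Cvec R d)) :
  seq (R * 'cV[R[i]]_d) := [seq (atom X x, x : 'cV[R[i]]_d) | x <- s].

Lemma atom_list_prob (X : {RV P >-> Cvec R d}) s : uniq s -> (forall w, X w \in s) ->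
  prob_list (atom_list X s).
Proof.
move=> us Xs; split; first by move=> pw /mapP[x _ ->]; apply: atom_ge0.
have /eqP := expectation_finite_support (fun=> 1) us Xs.
rewrite (_ : (fun=> _) = cst 1) // expectation_cst eqe => /eqP E.
by rewrite big_map E; apply: eq_bigr => x _; rewrite mul1r.
Qed.

Lemma expectation_outer (X : {RV P >-> Cvec R d}) s : uniq s -> (forall w, X w \in s) ->
  expectation_mx P (fun w => outer (X w)) = outer_avg (atom_list X s).
Proof.
move=> us Xs; apply/matrixP => j k; rewrite mxE /expectationC.
rewrite (expectation_finite_support (fun x => complex.Re (outer (x : 'cV[R[i]]_d) j k)) us Xs).
rewrite (expectation_finite_support (fun x => complex.Im (outer (x : 'cV[R[i]]_d) j k)) us Xs).
rewrite /outer_avg big_map summxE /=.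
elim: (s) => [|x s' IH]; first by rewrite !big_nil.
rewrite !big_cons -IH [X in _ = X + _]mxE /=; case: (outer (x : 'cV[R[i]]_d) j k) => a b /=.
by apply/eqP; rewrite eq_complex /= !mul0r subr0 addr0 ![_ * atom X x]mulrC !eqxx.
Qed.

Lemma expectation_enorm (X : {RV P >-> Cvec R d}) s : uniq s -> (forall w, X w \in s) ->
  ('E_P[fun w => (enorm (X w) ^+ 2)%R] =
    (\sum_(pw <- atom_list X s) pw.1 * norm2 pw.2)%R%:E)%E.
Proof.
move=> us Xs.
rewrite (expectation_finite_support (fun x => enorm (x : 'cV[R[i]]_d) ^+ 2) us Xs).
by rewrite big_map; congr _%:E; apply: eq_bigr => x _; rewrite enorm_sqr mulrC.
Qed.

Variables (m : nat) (X : 'I_m -> {RV P >-> Cvec R d}).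

(** The vectors take finitely many joint values, so any predicate of them is a finite union of
    intersections of fibers. This avoids proving that [opnorm] is measurable. *)
Lemma measurable_joint_event (S : 'I_m -> seq (Cvec R d)) (Q : ('I_m -> Cvec R d) -> Prop) :
  (forall i w, X i w \in S i) -> measurable [set w | Q (fun i => X i w)].
Proof.
(* [N] bounds every list length, so joint values are coded by index functions into one finite
   type. *)
move=> XS; pose N := (\sum_i size (S i))%N.
pose val (c : {ffun 'I_m -> 'I_N.+1}) i := nth 0 (S i) (c i).
have -> : [set w | Q (fun i => X i w)] =
    \bigcup_(c in [set c | Q (val c)]) \bigcap_(i in [set: 'I_m]) (X i @^-1` [set val c i]).
  apply/seteqP; split => w /=.
    move=> Qw; pose c := [ffun i => inord (index (X i w) (S i))] : {ffun 'I_m -> 'I_N.+1}.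
    have vc i : val c i = X i w.
      rewrite /val ffunE inordK ?nth_index // ltnS (leq_trans (index_size _ _)) //.
      by rewrite /N (bigD1 i) //= leq_addr.
    exists c => [|i _ /=]; last by rewrite vc.
    by rewrite /= (_ : val c = fun i => X i w) //; apply/funext.
  move=> [c /= Qc Xc]; rewrite (_ : (fun i => X i w) = val c) //.
  by apply/funext => i; apply: Xc.
apply: fin_bigcup_measurable => [|c _]; first exact: finite_finset.
apply: fin_bigcap_measurable => [|i _]; first exact: finite_finset.
exact: measurable_fiber.
Qed.

Lemma independent_atom_gt0 (x : 'I_m -> Cvec R d) : mutually_independent X ->
  (forall i, 0 < atom (X i) (x i)) ->
  (0 < P (\bigcap_(i in [set: 'I_m]) (X i @^-1` [set x i])))%E.
Proof.
move=> indX x0; have := indX [set: 'I_m]%SET (fun i => [set x i]).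
rewrite (_ : [set` [set: 'I_m]%SET] = [set: 'I_m]); last first.
  by apply/seteqP; split => i //= _; rewrite inE.
move=> -> => [|i _]; last exact: measurable_Cvec1.
under eq_bigr do rewrite -atomE.
by rewrite prodEFin lte_fin prodr_gt0.
Qed.
End Events.

Theorem theorem1p4 (R : realType) (dT : measure_display)
  (T : measurableType dT) (P : probability T R) (eps : R) (m d : nat)
  (v : 'I_m -> {RV P >-> Cvec R d}) :
  0 < eps ->
  mutually_independent v ->
  (forall i, finitely_supported (v i)) ->
  \sum_(i < m) expectation_mx P (fun w => outer (v i w)) = 1%:M ->
  (forall i, ('E_P[fun w => (enorm (v i w) ^+ 2)%R] <= eps%:E)%E) ->
  (0 < P [set w | (opnorm (\sum_(i < m) outer (v i w))
                     <= (1 + Num.sqrt eps) ^+ 2)%R])%E.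

Proof.
move=> eps0 indv fv sum1 normv.
have [S HS] := choice (fun i => let: ex_intro2 s us vs := finite_support_seq (fv i) in
  ex_intro (fun s => uniq s /\ forall w, v i w \in s) s (conj us vs)).
have [||||f [fL fdet]] := @discrete_theorem R d _ (fun i => atom_list (v i) (S i))
  (index_enum 'I_m) eps eps0.
- exact: index_enum_uniq.
- by move=> i _; have [us vs] := HS i; apply: atom_list_prob.
- rewrite -sum1; apply: eq_bigr => i _; have [us vs] := HS i.
  by rewrite (expectation_outer us vs).
- move=> i _; have [us vs] := HS i.
  by have := normv i; rewrite (expectation_enorm us vs) lee_fin.
have {fL} fL i : f i \in atom_list (v i) (S i) /\ 0 < (f i).1.
  by apply: fL; rewrite mem_index_enum.
pose x i : Cvec R d := (f i).2.
have x0 i : 0 < atom (v i) (x i).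
  by have [/mapP[y _ E]] := fL i; rewrite /x E.
(* The event that every vector takes its selected value has positive probability by independence,
   and it is contained in the target event. *)
apply: lt_le_trans (independent_atom_gt0 indv x0) _.
have mG : measurable [set w | opnorm (\sum_(i < m) outer (v i w)) <= (1 + Num.sqrt eps) ^+ 2].
  pose Q (y : 'I_m -> Cvec R d) : Prop :=
    opnorm (\sum_(i < m) outer (y i : 'cV[R[i]]_d)) <= (1 + Num.sqrt eps) ^+ 2.
  by apply: (@measurable_joint_event _ _ _ _ _ _ v S Q) => i w; have [_] := HS i.
apply: le_measure; rewrite ?inE //.
  apply: fin_bigcap_measurable => [|i _]; first exact: finite_finset.
  exact: measurable_fiber.
move=> w /= vw; have -> : \sum_(i < m) outer (v i w) = \sum_i outer (f i).2.
  by apply: eq_bigr => i _; have /= -> := vw i I.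
apply: opnorm_le; [| exact: sqr_ge0 | exact: fdet].
elim/big_ind: _ => [|X Y pX pY|i _]; first exact: psd0.
  exact: psdD.
exact: psd_outer.
Qed.
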